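(* Let $n \geq 1$ be an integer, let $F_n$ be the free group of rank $n$ with basis $\{f_1, \dots, f_n\}$, and let $U_n \leq \mathrm{Aut}(F_n)$ be the group of all automorphisms of $F_n$ that are unitriangular with respect to this basis. Then $U_n$ is linear if and only if $n \leq 3$.
   Context: For $m \leq n$, $F_m$ denotes the subgroup of $F_n$ generated by $f_1, \dots, f_m$. An automorphism $\varphi$ of $F_n$ is called unitriangular (with respect to the basis $\{f_1,\dots,f_n\}$) if it is defined by a map of the form $f_1 \mapsto f_1$, $f_i \mapsto u_i f_i$ for $i = 2, \dots, n$, where $u_i = u_i(f_1,\dots,f_{i-1})$ is an element of $F_{i-1}$. Every tuple $(u_2, \dots, u_n)$ with $u_i \in F_{i-1}$ defines a unique such automorphism, and the set $U_n$ of all unitriangular automorphisms is a subgroup of $\mathrm{Aut}(F_n)$, called the unitriangular automorphism group of $F_n$. A group is called linear if it has a faithful representation by matrices over a field, i.e. if it embeds in $GL_d(K)$ for some positive integer $d$ and some field $K$. *)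

(* Defs.v *)
From HB Require Import structures.
From mathcomp Require Import all_boot matrix ssralg.
From mathcomp Require Import boolp classical_sets.

Set Implicit Arguments.
Unset Strict Implicit.
Unset Printing Implicit Defensive.

Local Open Scope classical_set_scope.
Local Open Scope group_scope.

(* The letter (x, b) stands for x if b = false and for x^-1 if b = true. *)
Definition linv (X : Type) (a : X * bool) : X * bool := (a.1, ~~ a.2).

Definition reduced (X : eqType) : pred (seq (X * bool)) :=
  sorted (fun a b => b != linv a).

Record free_group (X : choiceType) := FreeGroup {
  fg_word :> seq (X * bool);
  fg_reduced : reduced fg_word
}.

HB.instance Definition _ (X : choiceType) := [isSub for @fg_word X].
HB.instance Definition _ (X : choiceType) :=
  [Choice of free_group X by <:].

Section FreeGroup.
Variable X : choiceType.
Local Notation letter := (X * bool)%type.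
Implicit Types (a b : letter) (u v w : seq letter).

(* Left multiplication of a reduced word by a letter. *)
Definition push a w : seq letter :=
  if w is b :: w' then if b == linv a then w' else a :: w else [:: a].

Definition wmul u v : seq letter := foldr push v u.

Definition winv u : seq letter := rev (map (@linv X) u).

Lemma linvK : involutive (@linv X).
Proof. by case=> x b; rewrite /linv /= negbK. Qed.

Lemma reduced_push a w : reduced w -> reduced (push a w).
Proof.
case: w => [|b w] //= bw; case: ifPn => [_|ba]; first exact: path_sorted bw.
by rewrite /= ba.
Qed.

Lemma pushK a w : reduced w -> push (linv a) (push a w) = w.
Proof.
case: w => [|b w] /= bw; first by rewrite linvK eqxx.
case: eqP => [ba|_]; last by rewrite /= linvK eqxx.
case: w bw => [|c w] /=; first by rewrite ba.
by rewrite ba; case/andP => /negPf -> _.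
Qed.

Lemma reduced_wmul u v : reduced v -> reduced (wmul u v).
Proof. by move=> rv; elim: u => //= a u; apply: reduced_push. Qed.

Lemma wmuls0 u : reduced u -> wmul u [::] = u.
Proof.
elim: u => //= a u IHu ru; rewrite IHu; last exact: path_sorted ru.
by case: u ru {IHu} => //= b u /andP[/negPf ->].
Qed.

Lemma wmul_push a u v :
  reduced u -> reduced v -> wmul (push a u) v = push a (wmul u v).
Proof.
case: u => [|b u] //= ru rv; case: eqP => [->|] //=.
by rewrite -{1}[a]linvK pushK ?reduced_wmul.
Qed.

Lemma wmulA u v w :
  reduced v -> reduced w -> wmul (wmul u v) w = wmul u (wmul v w).
Proof.
move=> rv rw; elim: u => //= a u IHu.
by rewrite wmul_push ?reduced_wmul ?IHu.
Qed.

Lemma winvK : involutive winv.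
Proof. by move=> u; rewrite /winv map_rev revK mapK //; apply: linvK. Qed.

Lemma reduced_winv u : reduced u -> reduced (winv u).
Proof.
rewrite /reduced /winv rev_sorted sorted_map.
apply: sub_sorted => a b /=; apply: contra => /eqP/(can_inj linvK) e.
by rewrite e linvK.
Qed.

Lemma wmulV u : wmul (winv u) u = [::].
Proof.
elim: u => //= a u IHu.
by rewrite /winv /= rev_cons /wmul foldr_rcons /= linvK eqxx.
Qed.

Local Notation F := (free_group X).
Definition fg_one : F := @FreeGroup X [::] isT.
Definition fg_mul (x y : F) : F :=
  FreeGroup (reduced_wmul x (fg_reduced y)).
Definition fg_inv (x : F) : F := FreeGroup (reduced_winv (fg_reduced x)).

Lemma fg_mulA : associative fg_mul.
Proof.
by move=> x y z; apply: val_inj; rewrite /= wmulA ?fg_reduced.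
Qed.

Lemma fg_mul1 : left_id fg_one fg_mul.
Proof. by move=> x; apply: val_inj. Qed.

Lemma fg_mulr1 : right_id fg_one fg_mul.
Proof. by move=> x; apply: val_inj; rewrite /= wmuls0 ?fg_reduced. Qed.

Lemma fg_mulV : left_inverse fg_one fg_inv fg_mul.
Proof. by move=> x; apply: val_inj; rewrite /= wmulV. Qed.

Lemma fg_mulrV : right_inverse fg_one fg_inv fg_mul.
Proof.
by move=> x; apply: val_inj; rewrite /= -{1}[fg_word x]winvK wmulV.
Qed.

HB.instance Definition _ := isGroup.Build F
  fg_mulA fg_mul1 fg_mulr1 fg_mulV fg_mulrV.

Definition fgen (x : X) : F := @FreeGroup X [:: (x, false)] isT.

End FreeGroup.

(* Products are compositions: (phi * psi) x = phi (psi x). *)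
Record aut (G : groupType) := Aut {
  aut_fun :> G -> G;
  aut_inv : G -> G;
  autM : {morph aut_fun : x y / x * y};
  autK : cancel aut_fun aut_inv;
  autKV : cancel aut_inv aut_fun
}.

HB.instance Definition _ (G : groupType) := gen_eqMixin (aut G).
HB.instance Definition _ (G : groupType) := gen_choiceMixin (aut G).

Section AutGroup.
Variable G : groupType.
Implicit Types phi psi : aut G.

Lemma autP phi psi : phi =1 psi -> phi = psi.
Proof.
case: phi psi => [f f' fM fK fKV] [g g' gM gK gKV] /= /funext fg.
subst g; have fg' : f' = g'.
  by apply/funext => x; rewrite -{1}(gKV x) fK.
by subst g'; congr Aut; apply: Prop_irrelevance.
Qed.

Definition aut_one : aut G :=
  @Aut G id id (fun _ _ => erefl) (fun _ => erefl) (fun _ => erefl).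

Fact aut_mul_morph phi psi : {morph phi \o psi : x y / x * y}.
Proof. by move=> x y; rewrite /= !autM. Qed.

Definition aut_mul phi psi : aut G :=
  Aut (aut_mul_morph phi psi)
    (can_comp (@autK _ phi) (@autK _ psi))
    (can_comp (@autKV _ psi) (@autKV _ phi)).

Fact aut_inv_morph phi : {morph aut_inv phi : x y / x * y}.
Proof.
by move=> x y; apply: (can_inj (@autK _ phi)); rewrite autM !autKV.
Qed.

Definition aut_invg phi : aut G :=
  Aut (aut_inv_morph phi) (@autKV _ phi) (@autK _ phi).

Fact aut_mulA : associative aut_mul.
Proof. by move=> f g h; apply: autP. Qed.
Fact aut_mul1 : left_id aut_one aut_mul.
Proof. by move=> f; apply: autP. Qed.
Fact aut_mulr1 : right_id aut_one aut_mul.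
Proof. by move=> f; apply: autP. Qed.
Fact aut_mulV : left_inverse aut_one aut_invg aut_mul.
Proof. by move=> f; apply: autP => x; apply: autK. Qed.
Fact aut_mulrV : right_inverse aut_one aut_invg aut_mul.
Proof. by move=> f; apply: autP => x; apply: autKV. Qed.

HB.instance Definition _ := isGroup.Build (aut G)
  aut_mulA aut_mul1 aut_mulr1 aut_mulV aut_mulrV.

Lemma aut1 phi : phi 1 = 1.
Proof. by apply: (@mulgI _ (phi 1)); rewrite -autM !mulg1. Qed.

Lemma autV phi : {morph phi : x / x^-1}.
Proof.
by move=> x; apply: (@mulgI _ (phi x)); rewrite -autM !mulgV aut1.
Qed.

End AutGroup.

Definition is_subgroup (G : groupType) (H : set G) : Prop :=
  [/\ H 1, (forall x y, H x -> H y -> H (x * y))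
         & (forall x, H x -> H x^-1)].

Definition generated (G : groupType) (A : set G) : set G :=
  smallest (@is_subgroup G) A.

Lemma generated_subgroup (G : groupType) (A : set G) :
  is_subgroup (generated A).
Proof.
split=> [H [[]] //|x y Ax Ay H HA|x Ax H HA]; case: (HA) => -[_ HM HV] _.
  by apply: HM; [apply: Ax|apply: Ay].
by apply: HV; apply: Ax.
Qed.

(* The basis f_1, ..., f_n is indexed from 0: f_k is fgen of the ordinal k - 1.
   Hence F_m is generated by the fgen j with j < m, and for f_k = fgen i the
   subgroup F_(k-1) containing u_k is Fsub i. *)
Notation Free n := (free_group 'I_n).

Definition Fsub (n m : nat) : set (Free n) :=
  generated [set fgen j | j in [set j : 'I_n | (j < m)%N]].

Definition unitriangular (n : nat) (phi : aut (Free n)) : Prop :=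
  forall i : 'I_n,
    if i == 0 :> nat then phi (fgen i) = fgen i
    else exists2 u, Fsub i u & phi (fgen i) = u * fgen i.

Section Unitriangular.
Variable n : nat.
Implicit Types phi psi : aut (Free n).

Lemma Fsub_subgroup m : is_subgroup (@Fsub n m).
Proof. exact: generated_subgroup. Qed.

Lemma Fsub_mono m1 m2 : (m1 <= m2)%N -> @Fsub n m1 `<=` Fsub m2.
Proof.
move=> m12; apply: smallest_sub; first exact: Fsub_subgroup.
move=> _ [j /= jm <-]; apply: sub_gen_smallest.
by exists j => //=; apply: leq_trans m12.
Qed.

Lemma Fsub_gen m (j : 'I_n) : (j < m)%N -> Fsub m (fgen j).
Proof. by move=> jm; apply: sub_gen_smallest; exists j. Qed.

Lemma Fsub_aut m phi :
  (forall j : 'I_n, (j < m)%N -> Fsub m (phi (fgen j))) ->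
  forall x, Fsub m x -> Fsub m (phi x).
Proof.
move=> phiF; have [F1 FM FV] := Fsub_subgroup m.
apply: smallest_sub; last by move=> _ [j /= jm <-]; apply: phiF.
split; first by rewrite /= aut1.
  by move=> x y /= Fx Fy; rewrite autM; apply: FM.
by move=> x /= Fx; rewrite autV; apply: FV.
Qed.

Lemma unitriangularE phi : unitriangular phi <->
  forall i : 'I_n, exists2 u, Fsub i u & phi (fgen i) = u * fgen i.
Proof.
split=> U i; have:= U i; case: eqP => // i0.
  move=> ->; exists 1; last by rewrite mul1g.
  by have [] := Fsub_subgroup i.
case=> u Fu ->; have u1 : [set 1] u; last by rewrite u1 mul1g.
apply: Fu; split=> [|x [j]]; last by rewrite i0.
by split=> // [x y -> ->|x ->] /=; rewrite ?mulg1 ?invg1.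
Qed.

Lemma unitriangular_Fsub phi m : unitriangular phi ->
  forall x, Fsub m x -> Fsub m (phi x).
Proof.
move=> /unitriangularE U; apply: Fsub_aut => j jm; have [u Fu ->] := U j.
have [_ FM _] := Fsub_subgroup m.
by apply: FM; [apply: Fsub_mono Fu; apply: ltnW|apply: Fsub_gen].
Qed.

Lemma unitriangular1 : unitriangular (1 : aut (Free n)).
Proof.
apply/unitriangularE => i; exists 1; last by rewrite mul1g.
by have [] := Fsub_subgroup i.
Qed.

Lemma unitriangularM phi psi :
  unitriangular phi -> unitriangular psi -> unitriangular (phi * psi).
Proof.
move=> Uphi Upsi; apply/unitriangularE => i.
have [u Fu eu] := (unitriangularE phi).1 Uphi i.
have [v Fv ev] := (unitriangularE psi).1 Upsi i.
exists (phi v * u); last by rewrite -[LHS]/(phi (psi _)) ev autM eu mulgA.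
have [_ FM _] := Fsub_subgroup i.
by apply: FM => //; apply: unitriangular_Fsub.
Qed.

Lemma unitriangularV phi : unitriangular phi -> unitriangular phi^-1.
Proof.
move=> Uphi.
have VE (i : 'I_n) : exists2 u, Fsub i u &
    phi^-1 (fgen i) = (phi^-1 u)^-1 * fgen i.
  have [u Fu eu] := (unitriangularE phi).1 Uphi i; exists u => //.
  apply: (can_inj (@autK _ phi)); rewrite autM autV eu.
  by rewrite !(@autKV _ phi : cancel phi^-1 phi) mulKg.
have VF m : forall x, Fsub m x -> Fsub m (phi^-1 x).
  elim: m {-2}m (leqnn m) => [|k IHk] m mk.
    by apply: Fsub_aut => j jm; have:= leq_trans jm mk.
  apply: Fsub_aut => j jm; have [u Fu ->] := VE j.
  have [_ FM FV] := Fsub_subgroup m.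
  apply: FM; last exact: Fsub_gen.
  apply: FV; apply: (@Fsub_mono j); first exact: ltnW.
  by apply: IHk => //; rewrite -ltnS (leq_trans jm mk).
apply/unitriangularE => i; have [u Fu ->] := VE i.
exists (phi^-1 u)^-1 => //.
have [_ _ FV] := Fsub_subgroup i.
by apply: FV; apply: VF.
Qed.

Definition unitri : {pred aut (Free n)} := fun phi => `[< unitriangular phi >].

Fact unitri_group_closed : group_closed unitri.
Proof.
split; first exact/asboolP/unitriangular1.
move=> f g /asboolP Uf /asboolP Ug; apply/asboolP.
by apply: unitriangularM => //; apply: unitriangularV.
Qed.

End Unitriangular.

Record Un (n : nat) := UnAut {
  un_aut :> aut (Free n);
  un_unitri : un_aut \in @unitri n
}.

HB.instance Definition _ (n : nat) := [isSub for @un_aut n].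
HB.instance Definition _ (n : nat) := [Choice of Un n by <:].
HB.instance Definition _ (n : nat) :=
  SubChoice_isSubGroup.Build _ _ (Un n) (@unitri_group_closed n).

Definition linear_group (G : groupType) : Prop :=
  exists (K : fieldType) (d : nat) (rho : G -> 'M[K]_d),
    [/\ (0 < d)%N,
        (forall x, rho x \in unitmx),
        {morph rho : x y / x * y >-> (x *m y)%R}
      & injective rho].

(* Main.v *)
Require Import Defs.
From mathcomp Require Import all_boot all_order all_algebra fingroup perm all_field.
From mathcomp Require Import boolp classical_sets ring lra zify.

(** For [n <= 3], [U_n] is represented over [Q(t)] by explicit 3x3 matrices for
    [f_1], [f_2] and the automorphism [f_2 |-> f_1 f_2]; faithfulness is read off
    the coefficients of highest degree in [t].

    For [n >= 4], put [A w : f_4 |-> w^-1 f_4] and [B w : f_3 |-> w^-1 f_3] for [w]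
    in [F_2].  They commute, and [A w * B w] is conjugate to [B w] (Formanek and
    Procesi).  In a linear representation, let [(a_i, b_i)] be the joint
    eigenvalues of [A g] and [B g] for [g] killed by all characters of [F_2]: the
    families [a_i b_i] and [b_i] agree, and the [a_i] with a given [b_i] have
    product 1, being the determinant of a representation.  This makes the
    logarithm of [b_i] a harmonic function on a balanced finite digraph, so that
    the [a_i] are roots of unity.  In characteristic [p], [A g] has finite order.
    In characteristic 0, the entries lie in a finitely generated ring, in which
    two primes [p] and [q] are not invertible; if moreover [A g] is congruent to 1
    modulo [p] and modulo [q], it is unipotent.  Such [g] would form a nonabelian
    subgroup of [F_2] on which the faithful [A] is unipotent, and Kolchin's theorem
    would provide a central element. *)

Set Implicit Arguments.
Unset Strict Implicit.
Unset Printing Implicit Defensive.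

(** * Torsion from balanced multiplicative relations *)

Section BalancedPairs.
Import Order.TTheory GRing.Theory Num.Theory.
Local Open Scope ring_scope.

Lemma clear_denominators n (w : 'rV[rat]_n) :
  exists2 c : int, c != 0 & exists w' : 'rV[int]_n, c%:~R *: w = map_mx intr w'.
Proof.
exists (\prod_k denq (w 0 k)); first by apply/prodf_neq0 => k _; rewrite denq_neq0.
exists (\row_k (numq (w 0 k) * \prod_(l | l != k) denq (w 0 l))).
apply/rowP => k; rewrite !mxE (bigD1 k) //= !rmorphM /= mulrAC; congr (_ * _).
by rewrite mulrC -{1}[w 0 k]divq_num_den divfK // intr_eq0 denq_neq0.
Qed.

Section Core.
Variables (L : fieldType) (n : nat) (a b : 'I_n -> L) (sigma : 'S_n).
Hypothesis b_neq0 : forall i, b i != 0.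
Hypothesis ab_sigma : forall i, a i * b i = b (sigma i).
Hypothesis prod_a : forall i, \prod_(j | b j == b i) a j = 1.

(** The predicate of [pick] depends on [b i] only, so [r] selects one representative in each class
    of indices with equal [b]; as [i] itself qualifies, the default is never reached. *)
Let r (i : 'I_n) : 'I_n := odflt i [pick k | b k == b i].

Let b_r i : b (r i) = b i.
Proof. by rewrite /r; case: pickP => //= k /eqP. Qed.

Let r_eq i j : (r j == r i) = (b j == b i).
Proof.
apply/eqP/eqP => [e|e]; first by rewrite -(b_r j) e b_r.
rewrite /r -e; case: pickP => //= /(_ j); by rewrite eqxx.
Qed.

Let e_ (i : 'I_n) : 'rV[int]_n := delta_mx 0 i.

(** Up to sign, the Laplacian of the digraph with one edge [r j -> r (sigma j)] for each [j]; rows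
    at indices that represent no class are zero. *)
Let Lap : 'M[int]_n :=
  \matrix_k \sum_(j | r j == k) (e_ (r (sigma j)) - e_ k).

(** Vectors are exponents of monomials in the [b k], so that linear relations over the integers
    become multiplicative relations in [L]. *)
Let ev (v : 'rV[int]_n) : L := \prod_k b k ^ v 0 k.

Let evD v w : ev (v + w) = ev v * ev w.
Proof.
by rewrite /ev -big_split; apply: eq_bigr => k _; rewrite mxE expfzDr.
Qed.

Let ev0 : ev 0 = 1.
Proof. by rewrite /ev big1 // => k _; rewrite mxE expr0z. Qed.

Let evZ c v : ev (c *: v) = ev v ^ c.
Proof.
rewrite /ev (big_morph (fun x : L => x ^ c) (id1 := 1) (op1 := *%R)).
- by apply: eq_bigr => k _; rewrite mxE mulrC exprz_exp.
- by move=> x y; rewrite expfzMl.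
- by rewrite exp1rz.
Qed.

Let ev_e i : ev (e_ i) = b i.
Proof.
rewrite /ev (bigD1 i) //= big1 ?mulr1 => [|k ki]; first by rewrite mxE !eqxx expr1z.
by rewrite mxE (negPf ki) andbF expr0z.
Qed.

Let evB v w : ev w != 0 -> ev (v - w) = ev v / ev w.
Proof. by move=> w0; rewrite evD -scaleN1r evZ exprN1. Qed.

(** The ratios [b (sigma j) / b j] are the [a j], whose product over a class is 1. *)
Let ev_row k : ev (row k Lap) = 1.
Proof.
rewrite rowK (big_morph ev evD ev0).
case: (pickP (fun j => r j == k)) => [j0 /eqP rj0|]; last by move=> p0; rewrite big_pred0.
rewrite -{2}(prod_a j0); apply: congr_big => // [j|j].
  by rewrite -rj0 r_eq.
move=> /eqP <-; rewrite evB !ev_e ?b_neq0 // !b_r -ab_sigma mulfK //.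
Qed.

Let ev_mul v : ev (v *m Lap) = 1.
Proof.
rewrite mulmx_sum_row (big_morph ev evD ev0) big1 // => k _.
by rewrite evZ ev_row exp1rz.
Qed.

Let LapQ : 'M[rat]_n := map_mx intr Lap.

(* Since the digraph with edges [r j -> r (sigma j)] has equal in- and
   out-degrees, the sum of the squared differences of a harmonic function along
   the edges vanishes. *)
Let harmonic (u : 'cV[rat]_n) : LapQ *m u = 0 ->
  forall i, u (r (sigma i)) 0 = u (r i) 0.
Proof.
move=> Lu; pose f j : rat := u (r j) 0.
have Lk k : \sum_(j | r j == k) (f (sigma j) - u k 0) = 0 :> rat.
  have Lk0 : (LapQ *m u) k 0 = 0 by rewrite Lu mxE.
  apply: etrans Lk0.
  transitivity ((row k LapQ *m u) 0 0); last by rewrite -row_mul mxE.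
  have -> : row k LapQ = \sum_(j | r j == k)
      (delta_mx 0 (r (sigma j)) - delta_mx 0 k).
    rewrite /LapQ -map_row rowK (big_morph (map_mx (intr : int -> rat)) (fun x y => map_mxD _ x y) (map_mx0 _ _ _)); apply: eq_bigr => j _.
    by rewrite map_mxB !map_delta_mx.
  rewrite mulmx_suml summxE. apply: eq_bigr => j _.
  by rewrite mulmxBl -!rowE !mxE.
have L0 : \sum_j f j * (f (sigma j) - f j) = 0.
  rewrite (partition_big r predT) //= big1 // => k _.
  have uLk := congr1 ( *%R (u k 0)) (Lk k); rewrite mulr0 mulr_sumr in uLk.
  apply: etrans uLk.
  by apply: eq_bigr => j /eqP <-.
have S : \sum_j (f (sigma j) - f j) ^+ 2 = 0.
  have -> : \sum_j (f (sigma j) - f j) ^+ 2 =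
     \sum_j f (sigma j) ^+ 2 - \sum_j f j ^+ 2
       - (\sum_j f j * (f (sigma j) - f j)) *+ 2.
    rewrite -sumrMnl -!sumrB; apply: eq_bigr => j _; ring.
  by rewrite L0 mul0rn subr0 [X in _ - X](reindex_inj (@perm_inj _ sigma)) subrr.
move=> i; have /eqP := S.
rewrite psumr_eq0 => [|j _]; last exact: sqr_ge0.
by move=> /allP/(_ i); rewrite mem_index_enum /= sqrf_eq0 subr_eq0 => /(_ isT)/eqP.
Qed.

(** The columns of the cokernel of [LapQ] are harmonic, hence annihilated by [d], which therefore
    lies in the rational row space of [Lap]. A nonzero multiple [c *: d] is then an integral
    combination of rows, and [ev] turns this into [a i ^ c = 1]. *)
Lemma balanced_family_torsion i : exists2 N, (0 < N)%N & a i ^+ N = 1.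
Proof.
pose d := e_ (r (sigma i)) - e_ (r i).
have : (map_mx intr d <= LapQ)%MS.
  rewrite submxE; apply/eqP/rowP => j.
  have := @harmonic (col j (cokermx LapQ)).
  rewrite colE mulmxA mulmx_coker mul0mx -colE => /(_ erefl i) hj.
  rewrite /d map_mxB !map_delta_mx mulmxBl -!rowE [RHS]mxE.
  by move: hj; rewrite !mxE => ->; rewrite subrr.
move=> /submxP[w dw]; have [c c0 [w' cw]] := clear_denominators w.
have cd : c *: d = w' *m Lap.
  have cdQ : map_mx (intr : int -> rat) (c *: d) = map_mx intr (w' *m Lap).
    by rewrite map_mxM -cw -scalemxAl -dw map_mxZ.
  apply/matrixP => x y; apply: (@intr_inj rat).
  by have /matrixP/(_ x y) := cdQ; rewrite ![map_mx _ _ _ _]mxE.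
have ac : a i ^ c = 1.
  have <- : ev (w' *m Lap) = a i ^ c; last exact: ev_mul.
  by rewrite -cd evZ evB !ev_e ?b_neq0 // !b_r -ab_sigma mulfK.
exists `|c|%N; first by rewrite absz_gt0.
case: c c0 {cw cd} ac => m _ //= am.
by rewrite -[LHS]invrK (am : (a i ^+ m.+1)^-1 = 1) invr1.
Qed.

End Core.

Lemma balanced_pairs_torsion (L : fieldType) (s : seq (L * L)) :
  (forall x, x \in s -> x.2 != 0) ->
  perm_eq [seq x.1 * x.2 | x <- s] [seq x.2 | x <- s] ->
  (forall c, \prod_(x <- s | x.2 == c) x.1 = 1) ->
  exists2 N, (0 < N)%N & forall x, x \in s -> x.1 ^+ N = 1.
Proof.
move=> s0 sp s1; pose t := in_tuple s.
have/tuple_permP[sg esg] : perm_eq (map_tuple (fun x => x.1 * x.2) t)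
   (map_tuple (fun x => x.2) t) by [].
have e1 : map_tuple (fun x => x.1 * x.2) t =
  [tuple tnth (map_tuple (fun x => x.2) t) (sg i) | i < size s] by apply: val_inj.
have H i : exists N, (0 < N)%N /\ (tnth t i).1 ^+ N = 1.
  suff [N N0 NE] : exists2 N, (0 < N)%N & (tnth t i).1 ^+ N = 1 by exists N.
  apply: (@balanced_family_torsion L _ (fun i => (tnth t i).1)
    (fun i => (tnth t i).2) sg) => [j|j|j].
  - exact/s0/mem_tnth.
  - have := congr1 (fun z => tnth z j) e1.
    by rewrite tnth_mktuple !tnth_map.
  - by rewrite -[RHS](s1 (tnth t j).2) [RHS]big_tnth.
have [N HN] := choice H.
exists (\prod_i N i)%N; first by rewrite prodn_gt0 // => i; have [] := HN i.
move=> x xs; have /tnthP[i ->] : x \in t by []; rewrite (bigD1 i) //= exprM.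
by have [_ ->] := HN i; rewrite expr1n.
Qed.

End BalancedPairs.

(** * Joint eigenvalues and splitting extensions *)

Section JointEigenvalues.
Import GRing.Theory.
Local Open Scope ring_scope.

Lemma char_poly_sim (F : fieldType) n (P A A' : 'M[F]_n) :
  P \in unitmx -> P *m A = A' *m P -> char_poly A = char_poly A'.
Proof.
move=> Pu PA; pose Pp := map_mx polyC P.
have Ppu : \det Pp != 0 by rewrite det_map_mx polyC_eq0 -unitfE -unitmxE.
apply: (mulfI Ppu); rewrite /char_poly -det_mulmx [RHS]mulrC -det_mulmx.
rewrite /char_poly_mx mulmxBl mulmxBr -!map_mxM PA.
by rewrite mul_mx_scalar mul_scalar_mx.
Qed.

Lemma char_poly_lblock (R : comNzRingType) r s (A : 'M[R]_r) (C : 'M_(s, r)) (D : 'M_s) :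
  char_poly (block_mx A 0 C D) = char_poly A * char_poly D.
Proof.
rewrite /char_poly /char_poly_mx scalar_mx_block map_block_mx opp_block_mx.
by rewrite add_block_mx map_mx0 oppr0 addr0 det_lblock.
Qed.

(** Substituting [X / c] for [X] turns [X - x] into [(X - c x) / c]; the powers of [c] come from the
    determinant. *)
Lemma char_poly_scale (F : fieldType) n (c : F) (A : 'M_n) (s : seq F) :
  c != 0 -> char_poly A = \prod_(x <- s) ('X - x%:P) ->
  char_poly (c *: A) = \prod_(x <- s) ('X - (x * c)%:P).
Proof.
move=> c0 As.
have sz : size s = n.
  by apply: succn_inj; rewrite -(size_char_poly A) As size_prod_XsubC.
pose f : {rmorphism {poly F} -> {poly F}} := comp_poly (c^-1%:P * 'X).
have cA : char_poly_mx (c *: A) = c%:P *: map_mx f (char_poly_mx A).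
  apply/matrixP => i j; rewrite !mxE rmorphB /= comp_polyC rmorphMn /= comp_polyX.
  rewrite mulrBr polyCM; congr (_ - _).
  by rewrite -mulrnAr mulrA -polyCM divff // mul1r.
rewrite /char_poly cA detZ det_map_mx -/(char_poly A) As rmorph_prod -sz /=.
have -> : c%:P ^+ size s = \prod_(x <- s) c%:P.
  by rewrite big_const_seq count_predT -Monoid.iteropE.
rewrite -big_split; apply: eq_bigr => x _ /=.
rewrite comp_polyB comp_polyX comp_polyC mulrBr mulrA -!polyCM divff // mul1r.
by rewrite mulrC.
Qed.

Lemma prod_XsubC_at0 (R : comNzRingType) (s : seq R) :
  (\prod_(x <- s) ('X - x%:P)).[0] = (-1) ^+ size s * \prod_(x <- s) x.
Proof.
rewrite horner_prod; elim: s => [|x s IHs]; first by rewrite !big_nil mulr1.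
by rewrite !big_cons IHs !hornerE /= exprS; ring.
Qed.

Lemma det_prod_eigenvalues (F : fieldType) n (A : 'M[F]_n) (s : seq F) :
  char_poly A = \prod_(x <- s) ('X - x%:P) -> \det A = \prod_(x <- s) x.
Proof.
move=> As; have sz : size s = n.
  by apply: succn_inj; rewrite -(size_char_poly A) As size_prod_XsubC.
apply: (mulrI (unitrX n (unitrN1 F))); rewrite -char_poly_det -horner_coef0 As.
by rewrite prod_XsubC_at0 sz.
Qed.

Lemma split_factors (F : fieldType) (p q : {poly F}) (s : seq F) :
  p \is monic -> q \is monic -> p * q = \prod_(x <- s) ('X - x%:P) ->
  exists t, p = \prod_(x <- t) ('X - x%:P).
Proof.
move=> pm qm pq.
have /dvdp_prod_XsubC[m pE] : p %| \prod_(x <- s) ('X - x%:P) by rewrite -pq dvdp_mulr.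
exists (mask m s); apply/eqP; rewrite -eqp_monic //.
by apply: rpred_prod => x _; apply: monicXsubC.
Qed.

(** Naming the rank [r] makes it a variable in the types, as block decompositions require. *)
Lemma rank_row_base (F : fieldType) m n (W : 'M[F]_(m, n)) r :
  \rank W = r -> exists2 U : 'M_(r, n), row_free U & (U :=: W)%MS.
Proof.
move=> <-; exists (row_base W); first exact: row_base_free.
exact: eq_row_base.
Qed.

Lemma stable_lblock (F : fieldType) r s (U : 'M[F]_(r, r + s)) (U' : 'M_(s, r + s))
    (P := col_mx U U') (M : 'M_(r + s)) :
  P \in unitmx -> (U *m M <= U)%MS -> ursubmx (P *m M *m invmx P) = 0.
Proof.
move=> Pu /submxP[D UM].
have -> : ursubmx (P *m M *m invmx P) = rsubmx (usubmx (P *m M *m invmx P)) by [].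
have UP : U *m invmx P = row_mx 1%:M 0.
  have: P *m invmx P = 1%:M by rewrite mulmxV.
  by rewrite /P mul_col_mx scalar_mx_block /block_mx => /eq_col_mx[].
rewrite /P !mul_col_mx col_mxKu UM -mulmxA -/P UP mul_mx_row row_mxKr.
by rewrite mulmx0.
Qed.

(** Since [G] is a group and [chi 1 = 1], the values of [chi] are nonzero: these are the linear
    characters over [F]. *)
Definition char_trivial (F : fieldType) (G : groupType) (g : G) :=
  forall chi : G -> F, {morph chi : x y / (x * y)%g >-> x * y} ->
    chi 1%g = 1 -> chi g = 1.

(* Block triangularization along an eigenspace of [B], which is stable under the
   whole group: the determinant of [A] on it is a character, hence trivial at [g]. *)
Lemma joint_eigenvalues (F : fieldType) (G : groupType) (g : G) n
    (A : G -> 'M[F]_n) (B : 'M[F]_n) (sa sb : seq F) :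
  char_trivial F g ->
  {morph A : x y / (x * y)%g >-> x *m y} -> A 1%g = 1%:M ->
  (forall h, A h *m B = B *m A h) -> B \in unitmx ->
  char_poly (A g) = \prod_(x <- sa) ('X - x%:P) ->
  char_poly B = \prod_(x <- sb) ('X - x%:P) ->
  exists s : seq (F * F),
  [/\ char_poly (A g) = \prod_(x <- s) ('X - x.1%:P),
      char_poly B = \prod_(x <- s) ('X - x.2%:P),
      char_poly (A g *m B) = \prod_(x <- s) ('X - (x.1 * x.2)%:P),
      forall c, \prod_(x <- s | x.2 == c) x.1 = 1
    & forall x, x \in s -> x.2 != 0].
Proof.
move=> gt; have [k] := ubnP n; elim: k => // k IHk in n A B sa sb *.
move=> nk AM A1 AB Bu sAg sB.
case: n => [|n] in A B AM A1 AB Bu sAg sB nk *.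
  exists [::]; rewrite !big_nil /char_poly !det_mx00; split=> // c.
  by rewrite big_nil.
have [b sbb] : exists b, b \in sb.
  case: sb sB => [|b sb] sB; last by exists b; rewrite inE eqxx.
  by have := size_char_poly B; rewrite sB big_nil size_poly1.
have rb : root (char_poly B) b by rewrite sB root_prod_XsubC.
have b0 : b != 0.
  apply/eqP => b0; move: rb; rewrite b0 rootE horner_coef0 char_poly_det.
  by rewrite mulf_eq0 signr_eq0 /=; apply/negP; rewrite -unitfE -unitmxE.
pose W := eigenspace B b.
have rW0 : (0 < \rank W)%N.
  by rewrite lt0n mxrank_eq0; move: rb; rewrite -eigenvalue_root_char.
(* The dimension becomes a sum of variables, so that matrices split into blocks along the eigenspace
   and a complement. *)
have [r [s [rs rW]]] : exists r s, n.+1 = (r + s)%N /\ \rank W = r.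
  by exists (\rank W), (n.+1 - \rank W)%N; rewrite subnKC ?rank_leq_row.
rewrite rW in rW0; move: (n.+1) rs => N rs in A B AM A1 AB Bu sAg sB nk rb W rW *.
subst N.
have [U Uf UW] := rank_row_base rW.
have [U' _ UW'] : exists2 U' : 'M_(s, r + s), row_free U' & (U' :=: W^C)%MS.
  by apply: rank_row_base; rewrite mxrank_compl rW addKn.
pose P := col_mx U U'.
have Pu : P \in unitmx.
  rewrite -row_full_unit -sub1mx -addsmxE (adds_eqmx UW UW').
  by rewrite sub1mx addsmx_compl_full.
have UB : U *m B = b *: U by apply/eigenspaceP; rewrite UW.
have UA h : (U *m A h <= U)%MS.
  rewrite UW; apply/eigenspaceP.
  by rewrite -mulmxA AB mulmxA UB -scalemxAl.
pose cj M := P *m M *m invmx P.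
have cjM M N : cj (M *m N) = cj M *m cj N.
  by rewrite /cj !mulmxA mulmxKV.
have cjE M : char_poly (cj M) = char_poly M.
  by apply/esym/(char_poly_sim Pu); rewrite /cj mulmxKV.
have blk M : (U *m M <= U)%MS ->
    cj M = block_mx (ulsubmx (cj M)) 0 (dlsubmx (cj M)) (drsubmx (cj M)).
  by move=> /(stable_lblock Pu) u0; rewrite -{1}[cj M]submxK u0.
pose A1' h := ulsubmx (cj (A h)); pose D h := drsubmx (cj (A h)).
have AE h : cj (A h) = block_mx (A1' h) 0 (dlsubmx (cj (A h))) (D h) by apply: blk.
pose E := drsubmx (cj B).
have UBU : (U *m B <= U)%MS by rewrite UB scalemx_sub.
have BE : cj B = block_mx b%:M 0 (dlsubmx (cj B)) E.
  rewrite {1}(blk _ UBU); congr block_mx.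
  have -> : ulsubmx (cj B) = lsubmx (usubmx (cj B)) by [].
  rewrite /cj mul_col_mx UB mul_col_mx col_mxKu -scalemxAl.
  have: P *m invmx P = 1%:M by rewrite mulmxV.
  rewrite /P mul_col_mx [1%:M]scalar_mx_block /block_mx => /eq_col_mx[-> _].
  by rewrite scale_row_mx row_mxKl scalemx1.
have A1M : {morph A1' : x y / (x * y)%g >-> x *m y}.
  move=> x y; have := AE (x * y)%g; rewrite AM cjM AE (AE y) mulmx_block.
  by move/eq_block_mx => [<- _ _ _]; rewrite mul0mx addr0.
have DM : {morph D : x y / (x * y)%g >-> x *m y}.
  move=> x y; have := AE (x * y)%g; rewrite AM cjM AE (AE y) mulmx_block.
  by move/eq_block_mx => [_ _ _ <-]; rewrite mulmx0 add0r.
have cj1 : cj 1%:M = block_mx 1%:M 0 0 1%:M.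
  by rewrite /cj mulmx1 mulmxV // scalar_mx_block.
have [A11 D1] : A1' 1%g = 1%:M /\ D 1%g = 1%:M.
  have := AE 1%g; rewrite A1 cj1 => /eq_block_mx[<- _ _ <-] //.
have DE h : D h *m E = E *m D h.
  have := congr1 cj (AB h); rewrite !cjM AE BE !mulmx_block.
  by move/eq_block_mx => [_ _ _]; rewrite !mulmx0 !add0r.
have cAg : char_poly (A g) = char_poly (A1' g) * char_poly (D g).
  by rewrite -cjE AE char_poly_lblock.
have cB : char_poly B = char_poly (b%:M : 'M_r) * char_poly E.
  by rewrite -cjE BE char_poly_lblock.
have cAB : char_poly (A g *m B) = char_poly (b *: A1' g) * char_poly (D g *m E).
  rewrite -cjE cjM AE BE mulmx_block !(mulmx0, mul0mx, addr0, add0r).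
  by rewrite char_poly_lblock mul_mx_scalar.
have Eu : E \in unitmx.
  rewrite unitmxE unitfE; have := Bu; rewrite unitmxE unitfE.
  have -> : \det B = \det (cj B) by rewrite /cj !det_mulmx mulrAC -det_mulmx mulmxV // det1 mul1r.
  by rewrite BE det_lblock mulf_eq0 negb_or => /andP[].
have [s1 s1E] : exists s1, char_poly (A1' g) = \prod_(x <- s1) ('X - x%:P).
  apply: (@split_factors _ _ (char_poly (D g)) sa); rewrite ?char_poly_monic //.
  by rewrite -cAg.
have [s2 s2E] : exists s1, char_poly (D g) = \prod_(x <- s1) ('X - x%:P).
  apply: (@split_factors _ _ (char_poly (A1' g)) sa); rewrite ?char_poly_monic //.
  by rewrite mulrC -cAg.
have [s3 s3E] : exists s1, char_poly E = \prod_(x <- s1) ('X - x%:P).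
  apply: (@split_factors _ _ (char_poly (b%:M : 'M_r)) sb); rewrite ?char_poly_monic //.
  by rewrite mulrC -cB.
have [|t [tA tB tAB t1 t0]] := IHk s D E s2 s3 _ DM D1 DE Eu s2E s3E.
  by rewrite -ltnS (leq_trans _ nk) // ltnS -{1}[s]add0n ltn_add2r.
exists ([seq (x, b) | x <- s1] ++ t); split.
- by rewrite big_cat big_map /= -s1E -tA.
- rewrite big_cat big_map /= -tB cB; congr (_ * _).
  have sz1 : size s1 = r.
    by apply: succn_inj; rewrite -(size_char_poly (A1' g)) s1E size_prod_XsubC.
  rewrite /char_poly /char_poly_mx map_scalar_mx -raddfB det_scalar /=.
  by rewrite big_const_seq count_predT -Monoid.iteropE sz1.
- by rewrite big_cat big_map /= cAB tAB (char_poly_scale b0 s1E).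
- move=> c; rewrite big_cat big_map /= t1 mulr1.
  case: (b == c); last by rewrite big_pred0.
  rewrite -(det_prod_eigenvalues s1E).
  apply: (gt (fun h => \det (A1' h))) => [x y|]; first by rewrite A1M det_mulmx.
  by rewrite A11 det1.
- by move=> x; rewrite mem_cat => /orP[/mapP[y _ ->] //|]; apply: t0.
Qed.

(** A divisor of least size above 1 is irreducible; adjoining a root of it splits off a linear
    factor, and the size decreases. *)
Lemma splitting_extension (F : fieldType) (p : {poly F}) : p \is monic ->
  exists (L : fieldType) (f : {rmorphism F -> L}) (s : seq L),
    map_poly f p = \prod_(x <- s) ('X - x%:P).
Proof.
have [k] := ubnP (size p); elim: k => // k IHk in F p *.
move=> pk pm; have [p1|p1] := leqP (size p) 1.
  exists F, idfun, [::]; rewrite big_nil map_poly_id //.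
  have/size_poly1P[c c0 pc] : size p == 1.
    by rewrite eqn_leq p1 size_poly_gt0 monic_neq0.
  by move: pm; rewrite pc monicE lead_coefC => /eqP ->.
pose Q d := exists q : {poly F}, [/\ size q = d, (1 < d)%N & q %| p].
have exQ : exists d, `[< Q d >] by exists (size p); apply/asboolP; exists p; rewrite dvdpp.
have [d /asboolP[q [qd d1 qp]] dmin] := ex_minnP exQ.
have irrq : irreducible_poly q.
  split=> [|r r1 rq]; first by rewrite qd.
  have q0 : q != 0 by rewrite -size_poly_gt0 qd ltnW.
  have r0 : r != 0 by apply: contraNneq q0 => r0; move: rq; rewrite r0 dvd0p.
  rewrite -dvdp_size_eqp // eqn_leq dvdp_leq //= qd; apply: dmin; apply/asboolP.
  exists r; split=> //; last exact: dvdp_trans qp.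
  by rewrite ltn_neqAle eq_sym r1 size_poly_gt0.
have [L _ [z zq _]] := irredp_FAdjoin irrq.
pose f : {rmorphism F -> L} := GRing.in_alg L.
have zp : root (map_poly f p) z.
  by apply: root_dvdp zq; rewrite dvdp_map.
have /factor_theorem[u pu] := zp.
have um : u \is monic.
  by rewrite -(monicMr u (monicXsubC z)) -pu monic_map.
have uk : (size u < k)%N.
  rewrite -(size_map_poly f) pu size_Mmonic ?monic_neq0 ?monicXsubC // in pk.
  by rewrite size_XsubC addn2 ltnS in pk.
have [L' [g [s us]]] := IHk _ u uk um.
exists L', (g \o f), (g z :: s).
by rewrite map_poly_comp pu rmorphM /= us big_cons map_polyXsubC mulrC.
Qed.

End JointEigenvalues.

(** * Finitely generated rings and their invertible primes *)

Section NonInvertiblePrimes.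
Import GRing.Theory.
Local Open Scope ring_scope.

(* No nonzero element of the subring [ev R] has powers divisible in it by infinitely
   many primes; in this form, the finiteness of the set of invertible primes passes to [R[x]]. *)
Definition few_primes_divide_powers (R : comNzRingType) (K : fieldType) (ev : {rmorphism R -> K}) :=
  forall s, ev s != 0 -> exists2 D, (0 < D)%N &
    forall p, prime p -> ~~ (p %| D)%N -> forall j r, ev s ^+ j <> p%:R * ev r.

Lemma intr_few_primes (K : fieldType) : [pchar K] =i pred0 ->
  few_primes_divide_powers (intr : {rmorphism int -> K}).
Proof.
move=> /pcharf0P K0.
have intrK0 (z : int) : (z%:~R == 0 :> K) = (z == 0).
  by case: z => n; rewrite ?NegzE ?rmorphN ?oppr_eq0 /= -pmulrn K0.
move=> s; rewrite intrK0 => s0; exists `|s|%N; first by rewrite absz_gt0.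
move=> p pp pD j r /eqP; rewrite -subr_eq0 -rmorphXn /= [p%:R]pmulrn -rmorphM -rmorphB /=.
rewrite intrK0 subr_eq0 => /eqP/(congr1 absz); rewrite abszX abszM /= => e.
case: j e => [|j] e.
  have : (p %| 1)%N by rewrite -[1%N]/(`|s| ^ 0)%N e dvdn_mulr.
  by rewrite dvdn1 => /eqP p1; rewrite p1 in pp.
case/negP: pD; have : (p %| `|s| ^ j.+1)%N by rewrite e dvdn_mulr.
by rewrite Euclid_dvdX // andbT.
Qed.

Section Adjoin.
Variables (R : comNzRingType) (K : fieldType) (ev : {rmorphism R -> K}) (x : K).
Local Notation m_ := (map_poly ev).

Definition eval_at : {rmorphism {poly R} -> K} := horner_eval x \o m_.

Lemma eval_atE q : eval_at q = (m_ q).[x]. Proof. by []. Qed.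

(** Degrees are measured in [K], since [ev] may kill coefficients; the leading coefficients are
    accordingly taken at the degree of the image. Multiplying by that of [r] replaces dividing by
    it. *)
Lemma pseudo_division (f r : {poly R}) : m_ r != 0 ->
  exists k (A B : {poly R}), lead_coef (m_ r) ^+ k *: m_ f = m_ r * m_ A + m_ B
    /\ (size (m_ B) < size (m_ r))%N.
Proof.
move=> r0; have [n] := ubnP (size (m_ f)); elim: n => // n IHn in f *.
rewrite ltnS => fn; have [fr|rf] := ltnP (size (m_ f)) (size (m_ r)).
  by exists 0%N, 0, f; rewrite scale1r rmorph0 mulr0 add0r.
pose a := r`_(size (m_ r)).-1; pose b := f`_(size (m_ f)).-1.
have aE : ev a = lead_coef (m_ r) by rewrite lead_coefE coef_map.
have bE : ev b = lead_coef (m_ f) by rewrite lead_coefE coef_map.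
pose t := b%:P * 'X^(size (m_ f) - size (m_ r)).
pose f' := a%:P * f - t * r.
have f'E : m_ f' = ev a *: m_ f - m_ t * m_ r.
  by rewrite rmorphB !rmorphM /= map_polyC mul_polyC.
have sr : (0 < size (m_ r))%N by rewrite size_poly_gt0.
have sf : (0 < size (m_ f))%N by apply: leq_trans rf.
have [|k [A [B [e sB]]]] := IHn f'.
  apply: leq_trans fn; rewrite -(prednK sf) ltnS.
  apply/leq_sizeP => j; rewrite f'E coefB coefZ rmorphM /= map_polyC map_polyXn.
  rewrite -mulrA ['X^_ * _]mulrC mulrA coefMXn coefCM.
  rewrite leq_eqVlt => /orP[/eqP <-|fj].
    have -> : ((size (m_ f)).-1 < size (m_ f) - size (m_ r))%N = false.
      apply/negbTE; rewrite -leqNgt -subn1 leq_sub2l //.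
    have -> : ((size (m_ f)).-1 - (size (m_ f) - size (m_ r)))%N = (size (m_ r)).-1.
      by rewrite -subn1 subnAC subKn // subn1.
    rewrite -!lead_coefE aE mulrC; apply/eqP; rewrite subr_eq0.
    by apply/eqP; congr (_ * _); apply/esym/bE.
  rewrite (prednK sf) in fj; rewrite [_`_j]nth_default // mulr0 sub0r.
  case: ifP => _; rewrite ?oppr0 // nth_default ?mulr0 ?oppr0 //.
  rewrite leq_subRL; last by rewrite (leq_trans (leq_subr _ _)) // ltnW.
  by rewrite subnK // ltnW.
exists k.+1, (A + (a ^+ k)%:P * t), B; split=> //.
have tE : m_ ((a ^+ k)%:P * t) = lead_coef (m_ r) ^+ k *: m_ t.
  by rewrite rmorphM /= map_polyC mul_polyC /= rmorphXn /= aE.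
rewrite rmorphD /= tE mulrDr addrAC -e f'E aE scalerBr scalerA -exprSr.
by rewrite -scalerAr [m_ r * _]mulrC subrK.
Qed.

(** When [x] is transcendental, an equality of values is an equality of polynomials over [K], and
    comparing leading coefficients brings it down to [R]. *)
Lemma transcendental_few_primes : (forall q, m_ q != 0 -> eval_at q != 0) ->
  few_primes_divide_powers ev -> few_primes_divide_powers eval_at.
Proof.
move=> trx evp s sx.
have s0 : m_ s != 0 by apply: contraNneq sx => s0; rewrite eval_atE s0 horner0.
pose lc (q : {poly R}) := q`_(size (m_ q)).-1.
have lcE (q : {poly R}) : ev (lc q) = lead_coef (m_ q) by rewrite lead_coefE coef_map.
have [|D D0 HD] := evp (lc s); first by rewrite lcE lead_coef_eq0.
exists D => // p pp pD j r e; apply: (HD p pp pD j (lc r)); rewrite !lcE.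
have : m_ (s ^+ j - p%:R * r) == 0.
  have [//|/trx/eqP[]] := eqVneq (m_ (s ^+ j - p%:R * r)) 0.
  by rewrite rmorphB rmorphXn rmorphM rmorph_nat /= e subrr.
rewrite rmorphB rmorphXn rmorphM rmorph_nat /= subr_eq0 => /eqP sj.
by rewrite -lead_coef_exp sj -polyC_natr lead_coefM lead_coefC.
Qed.

(* [M] is an annihilating polynomial of [x] of least degree and leading
   coefficient [a]; up to powers of [a], elements of the extension are uniquely
   polynomials in [x] of smaller degree.  [s] divides a nonzero constant [e]. *)
Lemma algebraic_few_primes q0 : m_ q0 != 0 -> eval_at q0 = 0 ->
  few_primes_divide_powers ev -> few_primes_divide_powers eval_at.
Proof.
move=> q00 q0x evp s sx.
pose Q d := exists q : {poly R}, [/\ size (m_ q) = d, m_ q != 0 & eval_at q = 0].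
have exQ : exists d, `[< Q d >] by exists (size (m_ q0)); apply/asboolP; exists q0.
have [d /asboolP[M [Md M0 Mx]] dmin] := ex_minnP exQ.
have small (q : {poly R}) : (size (m_ q) < size (m_ M))%N -> eval_at q = 0 -> m_ q = 0.
  move=> qM qx; have [//|qn0] := eqVneq (m_ q) 0.
  by move: qM; rewrite ltnNge Md dmin //; apply/asboolP; exists q.
pose a := M`_(size (m_ M)).-1.
have aE : ev a = lead_coef (m_ M) by rewrite lead_coefE coef_map.
have a0 : ev a != 0 by rewrite aE lead_coef_eq0.
have reduce (q : {poly R}) : exists l (c : {poly R}), (size (m_ c) < size (m_ M))%N /\
    ev a ^+ l * eval_at q = eval_at c.
  have [k [A [B [e sB]]]] := pseudo_division q M0; exists k, B; split=> //.
  have := congr1 (fun p => p.[x]) e; rewrite /= hornerZ hornerD hornerM.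
  by rewrite -!eval_atE Mx mul0r add0r aE.
(* Nonzero multiples of [s] in the extension, ordered by the size of a polynomial representing
   them. *)
pose E d := exists r h : {poly R}, [/\ size (m_ r) = d, eval_at r != 0 & eval_at r = eval_at s * eval_at h].
have exE : exists d, `[< E d >].
  by exists (size (m_ s)); apply/asboolP; exists s, 1; rewrite rmorph1 mulr1.
have [d' /asboolP[r [h [rd rx rsh]]] dmin'] := ex_minnP exE.
have r0 : m_ r != 0 by apply: contraNneq rx => r0; rewrite eval_atE r0 horner0.
have rM : (size (m_ r) < size (m_ M))%N.
  have [l [c [cM cE]]] := reduce r; apply: leq_ltn_trans cM.
  rewrite rd; apply: dmin'; apply/asboolP; exists c, ((a ^+ l)%:P * h); split=> //.
    by rewrite -cE mulf_neq0 ?expf_neq0.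
  rewrite -cE rsh rmorphM mulrCA; congr (_ * (_ * _)).
  by rewrite eval_atE map_polyC hornerC /= rmorphXn.
(* Otherwise the remainder of [M] by [r] vanishes at [x] by minimality of [r]; so does the quotient,
   which is then zero by its degree, and [M] is smaller than [r], contrary to [rM]. *)
have r1 : (size (m_ r) <= 1)%N.
  rewrite leqNgt; apply/negP => r1.
  have [k [A [B [e sB]]]] := pseudo_division M r0.
  have ex : eval_at r * eval_at A + eval_at B = 0.
    have := congr1 (fun p => p.[x]) e; rewrite /= hornerZ hornerD hornerM.
    by rewrite -!eval_atE Mx mulr0.
  have lr0 : lead_coef (m_ r) ^+ k != 0 by rewrite expf_neq0 // lead_coef_eq0.
  have B0 : eval_at B = 0.
    have [//|Bx] := eqVneq (eval_at B) 0.
    move: sB; rewrite ltnNge rd dmin' //; apply/asboolP; exists B, (- (h * A)); split=> //.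
    rewrite rmorphN rmorphM mulrN mulrA -rsh; apply/eqP.
    by rewrite -addr_eq0 addrC ex.
  have A0 : m_ A = 0.
    apply: small; last first.
      by apply: (mulfI rx); rewrite mulr0 -[RHS]ex B0 addr0.
    have [->|An0] := eqVneq (m_ A) 0; first by rewrite size_poly0 size_poly_gt0.
    rewrite -(size_scale (m_ M) lr0) e size_addl; last first.
      rewrite size_mul //; move: An0 sB; rewrite -size_poly_gt0.
      by move: (size (m_ A)) (size (m_ B)) (size (m_ r)) => ? ? ?; lia.
    rewrite size_mul //; move: r1 An0; rewrite -size_poly_gt0.
    by move: (size (m_ A)) (size (m_ r)) => ? ?; lia.
  have Mr : (size (m_ M) < size (m_ r))%N.
    by rewrite -(size_scale (m_ M) lr0) e A0 mulr0 add0r.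
  by move: (ltn_trans Mr rM); rewrite ltnn.
have [e eE] : exists e, eval_at r = ev e.
  exists r`_0; rewrite eval_atE [m_ r]size1_polyC // hornerC coef_map //.
have [|D D0 HD] := evp (a * e); first by rewrite rmorphM mulf_neq0 // -eE.
exists D => // p pp pD j t te.
have [l [c [cM cE]]] := reduce (t * h ^+ j).
(* Multiplied by [h ^+ j] and [a ^+ l], the relation equates values of polynomials smaller than [M],
   hence also their constant coefficients. *)
pose w := (a ^+ l * e ^+ j)%:P - p%:R * c.
have wE : m_ w = (ev (a ^+ l * e ^+ j))%:P - p%:R *: m_ c.
  rewrite /w rmorphB /= map_polyC; congr (_ - _).
  by rewrite rmorphM rmorph_nat -polyC_natr mul_polyC.
have w0 : m_ w = 0.
  apply: small.
    rewrite wE; apply: leq_ltn_trans (size_polyD _ _) _; rewrite gtn_max size_polyN.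
    rewrite (leq_ltn_trans (size_scale_leq _ _)) // andbT.
    rewrite (leq_ltn_trans (size_polyC_leq1 _)) //.
    by apply: leq_ltn_trans rM; rewrite size_poly_gt0.
  rewrite eval_atE wE hornerD hornerN hornerZ hornerC -eval_atE -cE.
  apply/eqP; rewrite subr_eq0; apply/eqP.
  rewrite rmorphM !rmorphXn /= -eE rsh exprMn te.
  by rewrite !(rmorphM, rmorphXn) /= -!mulrA [LHS]mulrCA.
(* The factor [a ^+ j * e ^+ l] completes the left side to a power of [a * e]. *)
apply: (HD p pp pD (l + j)%N (c`_0 * a ^+ j * e ^+ l)).
have := congr1 (fun q : {poly K} => q`_0) w0.
rewrite wE coefB coefC coefZ coef0 coef_map /= => /eqP; rewrite subr_eq0 => /eqP.
rewrite !rmorphM !rmorphXn /= => we.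
have -> : (ev a * ev e) ^+ (l + j) = (ev a ^+ l * ev e ^+ j) * (ev a ^+ j * ev e ^+ l).
  by rewrite exprMn !exprD; ring.
by rewrite we; ring.
Qed.

Lemma eval_at_few_primes : few_primes_divide_powers ev -> few_primes_divide_powers eval_at.
Proof.
have [[q q0 qx]|nex] := pselect (exists2 q, m_ q != 0 & eval_at q = 0).
  exact: algebraic_few_primes q0 qx.
apply: transcendental_few_primes => q q0; apply/eqP => qx; apply: nex.
by exists q.
Qed.

End Adjoin.

(** The elements of [xs] are adjoined in turn, so [R] is an iterated polynomial ring over [int]. *)
Lemma finitely_generated_few_primes (K : fieldType) (xs : seq K) : [pchar K] =i pred0 ->
  exists (R : comNzRingType) (ev : {rmorphism R -> K}), few_primes_divide_powers ev /\
    forall x, x \in xs -> exists r, x = ev r.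
Proof.
move=> K0; elim: xs => [|x xs [R [ev [evp evs]]]].
  by exists int, intr; split=> //; apply: intr_few_primes.
exists {poly R}, (eval_at ev x); split; first exact: eval_at_few_primes.
move=> y; rewrite inE => /orP[/eqP ->|/evs[r ->]].
  by exists 'X; rewrite eval_atE map_polyX hornerX.
by exists r%:P; rewrite eval_atE map_polyC hornerC.
Qed.

End NonInvertiblePrimes.

(** * Congruences modulo an integer, for scalars and matrices *)

Section Congruences.
Import GRing.Theory.
Local Open Scope ring_scope.

(** The ring may be noncommutative, as matrix rings are intended; [p%:R] is central in any case. *)
Definition eq_mod (R : pzRingType) (p : nat) (x y : R) := exists r, x = y + p%:R * r.

Lemma eq_modD (R : pzRingType) p (x y x' y' : R) :
  eq_mod p x y -> eq_mod p x' y' -> eq_mod p (x + x') (y + y').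
Proof. by move=> [r ->] [r' ->]; exists (r + r'); rewrite mulrDr addrACA. Qed.

Lemma eq_modM (R : pzRingType) p (x y x' y' : R) :
  eq_mod p x y -> eq_mod p x' y' -> eq_mod p (x * x') (y * y').
Proof.
move=> [r ->] [r' ->]; exists (r * y' + y * r' + r * (p%:R * r')).
rewrite mulrDl !mulrDr -!addrA; congr (_ + _).
by rewrite addrC -!addrA !mulrA -!(commr_nat _ p) -!mulrA; congr (_ + _); rewrite addrC.
Qed.

Lemma eq_mod_refl (R : pzRingType) p (x : R) : eq_mod p x x.
Proof. by exists 0; rewrite mulr0 addr0. Qed.

Lemma eq_mod_sum (R : pzRingType) p (I : Type) (s : seq I) (P : pred I) (f g : I -> R) :
  (forall i, P i -> eq_mod p (f i) (g i)) ->
  eq_mod p (\sum_(i <- s | P i) f i) (\sum_(i <- s | P i) g i).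
Proof.
move=> fg; apply: (big_ind2 (eq_mod p)) => //; first exact: eq_mod_refl.
exact: eq_modD.
Qed.

Lemma eq_mod_exp (R : pzRingType) p n (x y : R) : eq_mod p x y -> eq_mod p (x ^+ n) (y ^+ n).
Proof.
move=> xy; elim: n => [|n IHn]; first exact: eq_mod_refl.
by rewrite !exprS; apply: eq_modM.
Qed.

Lemma eq_mod_trans (R : pzRingType) p (x y z : R) :
  eq_mod p x y -> eq_mod p y z -> eq_mod p x z.
Proof. by move=> [r ->] [r' ->]; exists (r' + r); rewrite mulrDr addrA. Qed.

Lemma eq_mod_rmorph (R S : pzRingType) (f : {rmorphism R -> S}) p (x y : R) :
  eq_mod p x y -> eq_mod p (f x) (f y).
Proof. by move=> [r ->]; exists (f r); rewrite rmorphD rmorphM rmorph_nat. Qed.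

Lemma eq_mod_det (R : comPzRingType) n p (A B : 'M[R]_n) :
  (forall i j, eq_mod p (A i j) (B i j)) -> eq_mod p (\det A) (\det B).
Proof.
move=> AB; apply: eq_mod_sum => s _; apply: eq_modM; first exact: eq_mod_refl.
by apply: (big_ind2 (eq_mod p)) => //; [exact: eq_mod_refl|exact: eq_modM].
Qed.

Lemma freshman (R : comPzRingType) p (x y : R) : prime p ->
  eq_mod p ((x + y) ^+ p) (x ^+ p + y ^+ p).
Proof.
move=> pp; rewrite exprDn -(prednK (prime_gt0 pp)).
rewrite big_ord_recl big_ord_recr /= !subn0 bin0 mulr1n expr0 mulr1.
rewrite /bump leq0n add1n subnn binn mulr1n expr0 mul1r.
apply: eq_modD; first exact: eq_mod_refl.
rewrite -[X in eq_mod _ _ X]add0r; apply: eq_modD; last exact: eq_mod_refl.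
apply: (big_rec (fun z => eq_mod _ z 0)) => [|i z _ z0]; first exact: eq_mod_refl.
rewrite -[X in eq_mod _ _ X]addr0; apply: eq_modD z0.
have : (p %| 'C(p, bump 0 i))%N.
  by apply: prime_dvd_bin; rewrite // /bump /= add1n -ltn_predRL.
move=> /dvdnP[q bE]; rewrite (prednK (prime_gt0 pp)) bE.
by exists (x ^+ (p - bump 0 i) * y ^+ bump 0 i *+ q); rewrite add0r mulrnA mulr_natl.
Qed.

Lemma freshman_iter (R : comNzRingType) p k (x : R) : prime p ->
  eq_mod p ((1 + x) ^+ (p ^ k)) (1 + x ^+ (p ^ k)).
Proof.
move=> pp; elim: k => [|k IHk]; first by rewrite !expr1; apply: eq_mod_refl.
rewrite expnSr !exprM; apply: eq_mod_trans (eq_mod_exp p IHk) _.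
by have := freshman 1 (x ^+ (p ^ k)) pp; rewrite expr1n.
Qed.

(* Stated for matrices [1 + Y] by specializing the identity in [R[X]] at [Y]. *)
Lemma matrix_freshman (R : comNzRingType) n p k (Y : 'M[R]_n.+1) : prime p ->
  eq_mod p ((1 + Y) ^+ (p ^ k)) (1 + Y ^+ (p ^ k)).
Proof.
move=> pp; have := eq_mod_rmorph (horner_mx Y) (freshman_iter k 'X pp).
by rewrite rmorphXn !rmorphD rmorph1 /= rmorphXn /= horner_mx_X.
Qed.

(** By Bezout, 1 is a combination of [p] and [m]; if [p] divided [m] in the ring, it would divide
    1. *)
Lemma eq_mod_natr_unit (R : comNzRingType) (K : fieldType) (ev : {rmorphism R -> K}) p m r :
  (forall r, 1 <> p%:R * ev r) -> coprime p m -> m%:R <> p%:R * ev r.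
Proof.
move=> p1 pm e; have [p0|p0] := posnP p.
  move: pm; rewrite p0 /coprime gcd0n => /eqP m1.
  by apply: (p1 r); rewrite -e m1.
have [u v uv _] := egcdnP m p0; move: uv; rewrite (eqP pm) => uv.
apply: (p1 (u%:R - v%:R * r)).
rewrite rmorphB rmorphM !rmorph_nat mulrBr mulrCA -e -!natrM mulnC uv natrD.
by rewrite [(v * m)%:R + _]addrC addrK.
Qed.

(* [1 + h + ... + h^(m-1)] is congruent to [m] modulo [p], hence invertible. *)
Lemma coprime_unipotent (R : comNzRingType) (K : fieldType) (ev : {rmorphism R -> K})
    n p m k (Y : 'M[R]_n.+1) (h : 'M[K]_n.+1) :
  (forall r, 1 <> p%:R * ev r) -> coprime p m ->
  h = 1 + p%:R * map_mx ev Y -> (h ^+ m - 1) ^+ k = 0 -> (h - 1) ^+ k = 0.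
Proof.
move=> p1 pm hE hmk; pose h0 := 1 + p%:R * Y.
have hE0 : h = map_mx ev h0.
  rewrite hE /h0 -[map_mx ev (1 + _)]/(map_mx ev (1 + _)) rmorphD rmorph1 rmorphM /=.
  by rewrite rmorph_nat.
pose Phi0 := \sum_(i < m) h0 ^+ i.
pose Phi := \sum_(i < m) h ^+ i.
have PhiE : Phi = map_mx ev Phi0.
  rewrite /Phi /Phi0 rmorph_sum; apply: eq_bigr => i _.
  by rewrite rmorphXn /= -hE0.
have Phi1 : eq_mod p Phi0 m%:R.
  rewrite -[m in X in eq_mod _ _ X]card_ord -sum1_card natr_sum.
  apply: eq_mod_sum => i _; rewrite -[X in eq_mod _ _ X](expr1n _ i); apply: eq_mod_exp.
  by exists Y.
have [W WE] := Phi1.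
have [r rE] : eq_mod p (\det Phi0) (\det (m%:R : 'M[R]_n.+1)).
  apply: eq_mod_det => i j; rewrite WE mxE; exists (W i j); congr (_ + _).
  by rewrite mulr_natl mulr_natl mulmxnE.
have Phiu : Phi \is a GRing.unit.
  rewrite -[_ \is a _]/(Phi \in unitmx) unitmxE unitfE PhiE det_map_mx rE.
  apply/eqP => d0.
  have dm : \det (m%:R : 'M[R]_n.+1) = (m ^ n.+1)%:R.
    have -> : (m%:R : 'M[R]_n.+1) = (m%:R)%:M by rewrite (raddfMn scalar_mx).
    by rewrite det_scalar natrX.
  apply: (@eq_mod_natr_unit _ _ ev p (m ^ n.+1) (- r) p1).
    by rewrite coprimeXr.
  move/eqP: d0; rewrite rmorphD dm rmorph_nat rmorphM rmorph_nat addr_eq0 => /eqP ->.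
  by rewrite rmorphN mulrN.
have : (h - 1) ^+ k * Phi ^+ k = 0.
  rewrite -exprMn_comm; first by rewrite -subrX1.
  by apply/commr_sym/commrB; [apply/commr_sym/commr_sum => i _; apply/commrX|apply: commr1].
by move/(congr1 ( *%R^~ (Phi ^+ k)^-1)); rewrite mulrK ?unitrX // mul0r.
Qed.

(** The power [A ^+ (p ^ k)] is congruent to [1 + (A - 1) ^+ (p ^ k)], and [k <= p ^ k]. *)
Lemma unipotent_eq_mod (R : comNzRingType) (K : fieldType) (ev : {rmorphism R -> K})
    n p k (A0 : 'M[R]_n.+1) (A : 'M[K]_n.+1) : prime p -> A = map_mx ev A0 -> (A - 1) ^+ k = 0 ->
  exists2 q, (0 < q)%N & exists Y, A ^+ q = 1 + p%:R * map_mx ev Y.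
Proof.
move=> pp AE Ak; exists (p ^ k)%N; first by rewrite expn_gt0 prime_gt0.
have := matrix_freshman k (A0 - 1) pp => -[W]; rewrite addrC subrK => WE.
exists W; have := congr1 (map_mx ev) WE.
rewrite rmorphXn !rmorphD /= rmorph1 rmorphXn rmorphB rmorph1 rmorphM rmorph_nat /= -AE => ->.
by rewrite -(subnK (ltnW (ltn_expl k (prime_gt1 pp)))) exprD Ak mulr0 addr0.
Qed.

End Congruences.

(** * Unipotent matrices and Kolchin's theorem *)

Section Unipotent.
Import GRing.Theory.
Local Open Scope ring_scope.

(** All eigenvalues in a splitting extension vanish, so the characteristic polynomial is a power of
    ['X], and the trace is minus its coefficient of index [n]. *)
Lemma nilpotent_trace (F : fieldType) n (z : 'M[F]_n.+1) k : z ^+ k = 0 -> \tr z = 0.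
Proof.
move=> zk; have [L [f [s fs]]] := splitting_extension (char_poly_monic z).
have s0 x : x \in s -> x = 0.
  rewrite -root_prod_XsubC -fs map_char_poly -eigenvalue_root_char.
  move=> /eigenvalueP[v vz v0].
  have vk : v *m map_mx f z ^+ k = x ^+ k *: v.
    elim: k {zk} => [|k IHk]; first by rewrite !expr0 mulmx1 scale1r.
    by rewrite exprSr mulmxA IHk -scalemxAl vz scalerA exprSr.
  move: vk; rewrite -rmorphXn zk rmorph0 mulmx0 => /esym/eqP.
  by rewrite scaler_eq0 (negPf v0) orbF expf_eq0 => /andP[_ /eqP].
have fX : map_poly f (char_poly z) = 'X^(size s).
  rewrite fs (eq_big_seq (fun _ => 'X)) => [|x /s0 ->]; last by rewrite subr0.
  by rewrite big_const_seq count_predT -Monoid.iteropE.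
have sz : size s = n.+1.
  by apply: succn_inj; rewrite -(size_char_poly z) -(size_map_poly f) fX size_polyXn.
have := char_poly_trace z isT => /(congr1 f); rewrite -coef_map fX coefXn sz /=.
rewrite ltn_eqF // rmorphN => /esym/eqP; rewrite oppr_eq0 fmorph_eq0.
by move/eqP.
Qed.

(** The trace is cyclic, and exchanging the two factors of the rank factorization of [e] gives the
    identity of size [\rank e]. *)
Lemma idempotent_trace (F : fieldType) n (e : 'M[F]_n) : e *m e = e -> \tr e = (\rank e)%:R.
Proof.
move=> ee; rewrite -{1}(mulmx_base e) mxtrace_mulC.
have -> : row_base e *m col_base e = 1%:M; last by rewrite mxtrace1.
apply: (@row_full_inj _ _ _ _ (col_base e) (col_base_full e)).
apply: (row_free_inj (row_base_free e)).
by rewrite /= mulmx1 mulmxA mulmx_base -mulmxA mulmx_base.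
Qed.

(* Fitting: the idempotent projecting onto the invertible part of [z] is a
   polynomial in [z] without constant term, so its rank vanishes. *)
Lemma traces_nilpotent (F : fieldType) n (z : 'M[F]_n.+1) : [pchar F] =i pred0 ->
  (forall k, \tr (z ^+ k.+1) = 0) -> exists k, z ^+ k = 0.
Proof.
move=> /pcharf0P F0 trz.
have [k [q]] := multiplicity_XsubC (char_poly z) 0.
rewrite monic_neq0 ?char_poly_monic //= subr0 => q0 cE.
(* The exponent is [k.+1] rather than [k], so that [e] has no constant term in [z] even when
   [k = 0]. *)
have cop : coprimep ('X ^+ k.+1) q.
  by apply: coprimep_expl; rewrite coprimep_sym -['X]subr0 -polyC0 coprimep_XsubC.
have [[u v] /= uv] := Bezout_eq1_coprimepP _ _ cop.
pose h := horner_mx z.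
have hX : h 'X^(k.+1) = z ^+ k.+1 by rewrite /h rmorphXn /= horner_mx_X.
have zq : z ^+ k.+1 * h q = 0.
  have zX : 'X^(k.+1) * q = 'X * char_poly z by rewrite cE exprS -mulrA ['X^k * q]mulrC.
  by rewrite -hX -rmorphM zX rmorphM /= Cayley_Hamilton mulr0.
have tr_h p j : \tr (h p * z ^+ j.+1) = 0.
  elim/poly_ind: p j => [|p c IHp] j; first by rewrite /h rmorph0 mul0r raddf0.
  rewrite /h rmorphD rmorphM /= horner_mx_X horner_mx_C mulrDl -mulrA -exprS raddfD /= IHp.
  by rewrite add0r -[_ * _]/(_ *m _) mul_scalar_mx mxtraceZ trz mulr0.
pose e := h u * z ^+ k.+1.
have e1 : e = 1 - h v * h q.
  by apply/eqP; rewrite eq_sym subr_eq /e -hX -!rmorphM -rmorphD uv rmorph1.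
have ee : e *m e = e.
  rewrite -[LHS]/(e * e) {2}e1 mulrBr mulr1.
  have -> : e * (h v * h q) = h u * h v * (z ^+ k.+1 * h q).
    by rewrite /e -hX -!rmorphM; congr h; ring.
  by rewrite zq mulr0 subr0.
have /eqP := idempotent_trace ee; rewrite tr_h eq_sym F0 mxrank_eq0 => /eqP e0.
exists k.+1; rewrite -[LHS]mulr1.
have -> : 1 = h v * h q :> 'M_n.+1 by apply/eqP; rewrite -subr_eq0 -e1 e0.
have -> : z ^+ k.+1 * (h v * h q) = h v * (z ^+ k.+1 * h q).
  by rewrite -hX -!rmorphM; congr h; ring.
by rewrite zq mulr0.
Qed.

Section Kolchin.
Variables (F : fieldType) (n : nat) (T : Type) (A : T -> 'M[F]_n.+1) (mulT : T -> T -> T).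
Hypothesis F0 : [pchar F] =i pred0.
Hypothesis AM : forall s t, A (mulT s t) = A s * A t.
Hypothesis A_unip : forall t, exists k, (A t - 1) ^+ k = 0.

(** The image in matrices of the augmentation ideal of the group algebra. *)
Definition augmentation (z : 'M[F]_n.+1) :=
  exists cs : seq (F * T), z = \sum_(x <- cs) x.1 *: (A x.2 - 1).

Lemma augmentationD z z' : augmentation z -> augmentation z' -> augmentation (z + z').
Proof. by move=> [s ->] [s' ->]; exists (s ++ s'); rewrite big_cat. Qed.

Lemma augmentationZ c z : augmentation z -> augmentation (c *: z).
Proof.
move=> [s ->]; exists [seq (c * x.1, x.2) | x <- s]; rewrite big_map scaler_sumr.
by apply: eq_bigr => x _; rewrite scalerA.
Qed.

Lemma augmentation_gen t : augmentation (A t - 1).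
Proof. by exists [:: (1, t)]; rewrite big_seq1 scale1r. Qed.

Lemma augmentation0 : augmentation 0.
Proof. by exists [::]; rewrite big_nil. Qed.

Lemma augmentation_sum (I : Type) (s : seq I) (f : I -> 'M[F]_n.+1) :
  (forall i, augmentation (f i)) -> augmentation (\sum_(i <- s) f i).
Proof.
move=> fa; apply: (big_ind augmentation) => //; first exact: augmentation0.
exact: augmentationD.
Qed.

Lemma augmentationM z z' : augmentation z -> augmentation z' -> augmentation (z * z').
Proof.
move=> [s ->] [s' ->]; rewrite mulr_suml; apply: augmentation_sum => x.
rewrite mulr_sumr; apply: augmentation_sum => y.
rewrite -scalerAl -scalerAr; do 2!apply: augmentationZ.
have -> : (A x.2 - 1) * (A y.2 - 1) =
    (A (mulT x.2 y.2) - 1) + (-1) *: (A x.2 - 1) + (-1) *: (A y.2 - 1).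
  rewrite AM mulrBl !mulrBr !mulr1 mul1r !scaleN1r !opprB.
  by rewrite [_ - 1 + _]addrA subrK.
by do 2![apply: augmentationD; last by apply/augmentationZ/augmentation_gen];
  apply: augmentation_gen.
Qed.

(** Traces vanish on the augmentation ideal, because they do on its generators, and the powers of
    [z] stay in it. *)
Lemma augmentation_nil z : augmentation z -> exists k, z ^+ k = 0.
Proof.
have tr0 y : augmentation y -> \tr y = 0.
  move=> [s ->]; rewrite raddf_sum big1 //= => x _; rewrite linearZ /=.
  by have [k /nilpotent_trace ->] := A_unip x.2; rewrite mulr0.
move=> za; apply: traces_nilpotent => // k; apply: tr0.
by elim: k => [|k IHk]; rewrite ?expr1 // exprS; apply: augmentationM.
Qed.

(** Term of index [k] of the ascending series on whose successive quotients all [A t] act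
    trivially. *)
Fixpoint killed_by k (v : 'rV[F]_n.+1) : Prop :=
  if k is k'.+1 then forall t, killed_by k' (v *m (A t - 1)) else v = 0.

Lemma killed_by0 k : killed_by k 0.
Proof. by elim: k => //= k IHk t; rewrite mul0mx. Qed.

Lemma killed_byD k u v : killed_by k u -> killed_by k v -> killed_by k (u + v).
Proof.
elim: k u v => [|k IHk] u v /= ku kv; first by rewrite ku kv addr0.
by move=> t; rewrite mulmxDl; apply: IHk.
Qed.

Lemma killed_byN k v : killed_by k v -> killed_by k (- v).
Proof.
elim: k v => [|k IHk] v /= kv; first by rewrite kv oppr0.
by move=> t; rewrite mulNmx; apply: IHk.
Qed.

Lemma killed_byS k v : killed_by k v -> killed_by k.+1 v.
Proof.
elim: k v => [|k IHk] v; first by move=> /= -> t; rewrite mul0mx.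
by move=> kv t; apply: IHk; apply: kv.
Qed.

(** The multiples of [v] by the augmentation ideal form a subspace: take [S] of largest rank with
    row space made of such multiples. *)
Lemma orbit_span v : exists S : 'M[F]_n.+1,
  (forall z, augmentation z -> (v *m z <= S)%MS) /\
  (forall u : 'rV_n.+1, (u <= S)%MS -> exists2 z, augmentation z & u = v *m z).
Proof.
(* Here [d] is the corank, so that the least [d] gives the largest rank. *)
pose Q d := exists S : 'M[F]_n.+1, \rank S = (n.+1 - d)%N /\
  forall u : 'rV_n.+1, (u <= S)%MS -> exists2 z, augmentation z & u = v *m z.
have exQ : exists d, `[< Q d >].
  exists n.+1; apply/asboolP; exists 0; rewrite mxrank0 subnn; split=> // u.
  by rewrite submx0 => /eqP ->; exists 0; [apply: augmentation0|rewrite mulmx0].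
have [d /asboolP[S [rS HS]] dmin] := ex_minnP exQ; exists S; split=> // z za.
have [//|nzS] := boolP (v *m z <= S)%MS.
have rS' : (\rank S < \rank (S + v *m z)%MS)%N.
  by apply: rank_ltmx; rewrite /ltmx addsmxSl addsmx_sub submx_refl.
have rn : (\rank (S + v *m z)%MS <= n.+1)%N := rank_leq_col _.
have : (d <= n.+1 - \rank (S + v *m z)%MS)%N.
  apply: dmin; apply/asboolP; exists (S + v *m z)%MS; split; first by rewrite subKn.
  move=> u /sub_addsmxP[[D c] /= uE].
  have [y ya yE] := HS (D *m S) (submxMl _ _).
  exists (y + (c 0 0) *: z); first exact/augmentationD/augmentationZ.
  by rewrite uE yE mulmxDr -scalemxAr {1}[c]mx11_scalar mul_scalar_mx.
move: rS rS' rn; have := rank_leq_col S.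
by move: (\rank S) (\rank (S + v *m z)%MS) => a b; lia.
Qed.

(* The spaces [v I], with [I] the augmentation ideal, shrink along
   [v' = v (A t - 1)]: otherwise [v' = v' z] with [z] nilpotent. *)
Lemma kolchin v : killed_by n.+2 v.
Proof.
have [S SE] := choice orbit_span.
(* The rank of [S u] is at most [n.+1], which accounts for the index [n.+2]. *)
suff H k u : (\rank (S u) < k)%N -> killed_by k u.
  by apply: H; rewrite ltnS rank_leq_col.
elim: k u => // k IHk u; rewrite ltnS => ruk t /=.
have [->|u'0] := eqVneq (u *m (A t - 1)) 0; first exact: killed_by0.
apply: IHk; apply: leq_trans ruk; apply: rank_ltmx.
have [S1 S2] := SE u; have [S1' S2'] := SE (u *m (A t - 1)).
have uS : (u *m (A t - 1) <= S u)%MS by apply: S1; apply: augmentation_gen.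
rewrite /ltmx; apply/andP; split.
  apply/rV_subP => w /S2'[z za ->]; rewrite -mulmxA; apply: S1.
  by apply: augmentationM => //; apply: augmentation_gen.
apply/negP => SS; have /S2'[z za e] := submx_trans uS SS.
have [j zj] := augmentation_nil za.
move/eqP: u'0; apply; have -> : u *m (A t - 1) = u *m (A t - 1) *m z ^+ j.
  elim: j {zj} => [|j IHj]; first by rewrite expr0 mulmx1.
  by rewrite exprS mulmxA -e -IHj.
by rewrite zj mulmx0.
Qed.

Lemma killed_by_group j v t : killed_by j v -> killed_by j (v *m A t).
Proof.
move=> jv; have -> : v *m A t = v + v *m (A t - 1).
  by rewrite mulmxBr mulmx1 addrC subrK.
by apply: killed_byD => //; apply: (killed_byS jv).
Qed.

Definition lowers k (M : 'M[F]_n.+1) :=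
  forall j v, killed_by (j + k) v -> killed_by j (v *m M).

End Kolchin.

(* In a group of unipotent matrices, iterated commutators with the group act
   ever more trivially on the filtration of [kolchin], so that the last
   nontrivial one is central. *)
Lemma unipotent_group_center (F : fieldType) n (G : groupType) (H : set G)
    (A : G -> 'M[F]_n.+1) : [pchar F] =i pred0 -> is_subgroup H ->
  {morph A : x y / (x * y)%g >-> x * y} -> A 1%g = 1 ->
  (forall g, A g = 1 -> g = 1%g) ->
  (forall g, H g -> exists k, (A g - 1) ^+ k = 0) ->
  (exists2 g, H g & g <> 1%g) ->
  exists z, [/\ H z, z <> 1%g & forall g, H g -> (z * g = g * z)%g].
Proof.
move=> F0 [H1 HM HV] AM A1 Ainj Aun [x Hx x1].
pose T := {g : G | H g}; pose A' (t : T) := A (sval t).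
pose mulT (s t : T) : T := exist H (sval s * sval t)%g (HM _ _ (svalP s) (svalP t)).
have A'M s t : A' (mulT s t) = A' s * A' t by rewrite /A' AM.
have A'un t : exists k, (A' t - 1) ^+ k = 0 by apply: Aun; apply: svalP.
have kb := @kolchin F n T A' mulT F0 A'M A'un.
apply: contrapT => nz.
(* As no nontrivial element is central, [g] is replaced at each stage by its commutator with some
   [h], which lowers the filtration one step further. *)
have low k : exists g, [/\ H g, g <> 1%g & lowers A' k.+1 (A g - 1)].
  elim: k => [|k [g [Hg g1 gl]]].
    exists x; split=> // j v; rewrite addn1; exact: (fun kv => kv (exist H x Hx)).
  have [h Hh gh] : exists2 h, H h & (g * h)%g <> (h * g)%g.
    apply: contrapT => nh; apply: nz; exists g; split=> // h Hh.
    by apply: contrapT => gh; apply: nh; exists h.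
  pose c := (h * g)^-1%g; exists (g * h * c)%g.
  have Hc : H c by exact: HV (HM _ _ Hh Hg).
  split; first exact: HM (HM _ _ Hg Hh) Hc.
    by move=> /(congr1 (fun y => y * (h * g))%g); rewrite mulgKV mul1g.
  move=> j v kv.
  have -> : A (g * h * c)%g - 1 =
      ((A g - 1) * (A h - 1) - (A h - 1) * (A g - 1)) * A c.
    have E (a b : 'M[F]_n.+1) : (a - 1) * (b - 1) = a * b - (a + b - 1).
      by rewrite mulrBl !mulrBr !mulr1 mul1r -[LHS]addrA -opprD addrA.
    rewrite !E [A h + _]addrC; move: (A g + A h - 1) => d.
    by rewrite opprB addrA subrK mulrBl -!AM /c mulgV A1.
  rewrite -[_ * A c]/(_ *m A c) mulmxA.
  apply: (killed_by_group (exist H c Hc)).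
  rewrite mulmxBr; apply: killed_byD; last apply: killed_byN; rewrite -[_ * _]/(_ *m _) mulmxA.
  - have kv' : killed_by A' (j.+1 + k.+1) v by rewrite addSnnS.
    by have := gl _ _ kv'; move=> /(_ (exist H h Hh)).
  - apply: gl; move: kv; rewrite addnS => /(_ (exist H h Hh)); exact.
(* Now [A g - 1] lowers by [n.+2], hence annihilates the whole space. *)
have [g [Hg g1 gl]] := low n.+1.
apply/g1/Ainj/subr0_eq/row_matrixP => i; rewrite row0 rowE.
by apply: (gl 0%N); apply: kb.
Qed.

(** Over a field splitting both characteristic polynomials, similarity through [T] matches the
    products of joint eigenvalues with the eigenvalues of [B g], so those of [A g] are roots of
    unity. The characteristic polynomial of [A g] then divides [('X^N - 1) ^+ n.+1], and
    Cayley-Hamilton concludes. *)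
Lemma commuting_unipotent_power (F : fieldType) (G : groupType) (g : G) n
    (A B : G -> 'M[F]_n.+1) (T : 'M[F]_n.+1) :
  (forall L : fieldType, char_trivial L g) ->
  {morph A : x y / (x * y)%g >-> x * y} -> A 1%g = 1 ->
  (forall h, A h * B g = B g * A h) -> B g \in unitmx -> T \in unitmx ->
  A g * B g * T = T * B g ->
  exists2 N, (0 < N)%N & (A g ^+ N - 1) ^+ n.+1 = 0.
Proof.
move=> gt AM A1 AB Bu Tu ABT.
have pm : char_poly (A g) * char_poly (B g) \is monic.
  by rewrite monicMr char_poly_monic.
have [L [f [s fs]]] := splitting_extension pm.
pose m := map_mx f.
rewrite rmorphM /= !map_char_poly in fs.
have [sa saE] := split_factors (char_poly_monic (m _ _ (A g))) (char_poly_monic _) fs.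
rewrite mulrC in fs.
have [sb sbE] := split_factors (char_poly_monic _) (char_poly_monic _) fs.
have [||||t [tA tB tAB t1 t0]] := @joint_eigenvalues L G g n.+1 (fun h => map_mx f (A h)) (map_mx f (B g)) sa sb (gt L) _ _ _ _ saE sbE.
- by move=> x y; rewrite AM map_mxM.
- by rewrite A1 map_mx1.
- by move=> h; rewrite -!map_mxM; congr map_mx; apply: AB.
- by rewrite map_unitmx.
have ABsim : char_poly (map_mx f (A g) *m map_mx f (B g)) = char_poly (map_mx f (B g)).
  rewrite -map_mxM; apply/esym.
  by apply: (@char_poly_sim _ _ (map_mx f T)); rewrite ?map_unitmx // -!map_mxM; congr map_mx.
have [|N N0 NE] := balanced_pairs_torsion t0 _ t1.
  by apply: prod_XsubC_eq; rewrite !big_map -tAB -tB.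
exists N => //.
have dv : char_poly (A g) %| ('X^N - 1) ^+ n.+1.
  rewrite -(dvdp_map f) map_char_poly tA rmorphXn rmorphB /= map_polyXn rmorph1.
  have sz : size t = n.+1.
    by apply: succn_inj; rewrite -(size_char_poly (map_mx f (A g))) tA size_prod_XsubC.
  have : forall x, x \in t -> ('X - x.1%:P : {poly L}) %| 'X^N - 1.
    by move=> x xt; rewrite dvdp_XsubCl rootE !hornerE NE // subrr.
  rewrite -sz; elim: t {tA tB tAB t1 t0 NE sz} => [|x t IHt] tN.
    by rewrite big_nil dvd1p.
  rewrite big_cons exprS dvdp_mul //; first by apply: tN; rewrite inE eqxx.
  by apply: IHt => y yt; apply: tN; rewrite inE yt orbT.
have /dvdpP[q qE] := dv.
have := congr1 (horner_mx (A g)) qE.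
by rewrite rmorphM /= Cayley_Hamilton mulr0 rmorphXn rmorphB rmorphXn rmorph1 /= horner_mx_X.
Qed.

End Unipotent.

(** * Free groups: evaluation of words, and commutation in rank two *)

Section FreeGroups.
Local Open Scope group_scope.

Section WordEval.
Variables (X : choiceType) (T : Type) (op : T -> T -> T) (e : T) (v : X * bool -> T).
Hypothesis opA : associative op.
Hypothesis ope : left_id e op.
Hypothesis vK : forall a x, op (v a) (op (v (linv a)) x) = x.

Definition word_eval (w : free_group X) : T := foldr (fun a => op (v a)) e w.

(** Reduction only removes adjacent mutually inverse letters, which [vK] cancels. This form also
    applies to monoids of matrices. *)
Lemma word_evalM : {morph word_eval : x y / x * y >-> op x y}.
Proof.
move=> x y; rewrite /word_eval /=; elim: (fg_word x) => [|a w IHw] /=.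
  by rewrite ope.
rewrite -opA -IHw; move: (wmul w y) => u.
case: u => [|b u] //=; case: eqP => [->|] //=.
Qed.

End WordEval.

Definition fletter (X : choiceType) (a : X * bool) : free_group X :=
  if a.2 then (fgen a.1)^-1 else fgen a.1.

Lemma free_group_ind (X : choiceType) (P : free_group X -> Prop) :
  P 1 -> (forall a w, P w -> P (fletter a * w)) -> forall w, P w.
Proof.
move=> P1 PM [w rw]; elim: w rw => [|a w IHw] rw.
  by have -> : FreeGroup rw = 1 by apply: val_inj.
have rw' : reduced w by apply: path_sorted rw.
have -> : FreeGroup rw = fletter a * FreeGroup rw'; last exact/PM/IHw.
apply: val_inj => /=; have -> : fg_word (fletter a) = [:: a] by case: a {rw} => ? [].
rewrite /= /push; case: w rw {IHw rw'} => [|b w] //= /andP[/negPf ab _].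
by rewrite ab.
Qed.

Section GroupLift.
Variables (X : choiceType) (G : groupType) (h : X -> G).

Definition letter_image (a : X * bool) : G := if a.2 then (h a.1)^-1 else h a.1.

Definition flift : free_group X -> G := word_eval mulg 1 letter_image.

Fact letter_imageK a x : letter_image a * (letter_image (linv a) * x) = x.
Proof. by case: a => y []; rewrite /letter_image /= ?mulKg ?mulKVg. Qed.

Lemma fliftM : {morph flift : x y / x * y}.
Proof. exact: word_evalM (@mulgA G) (@mul1g G) letter_imageK. Qed.

Lemma flift1 : flift 1 = 1. Proof. by []. Qed.

Lemma flift_gen x : flift (fgen x) = h x.
Proof. by rewrite /flift /word_eval /= mulg1. Qed.

Lemma fliftV : {morph flift : x / x^-1}.
Proof. by move=> x; apply: (mulgI (flift x)); rewrite -fliftM !mulgV. Qed.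

End GroupLift.

Lemma hom1 (G G' : groupType) (f : G -> G') : {morph f : x y / x * y} -> f 1 = 1.
Proof. by move=> fM; apply: (mulgI (f 1)); rewrite -fM !mulg1. Qed.

Lemma homV (G G' : groupType) (f : G -> G') :
  {morph f : x y / x * y} -> {morph f : x / x^-1}.
Proof. by move=> fM x; apply: (mulgI (f x)); rewrite -fM !mulgV hom1. Qed.

Lemma free_hom_eq (X : choiceType) (G : groupType) (f g : free_group X -> G) :
  {morph f : x y / x * y} -> {morph g : x y / x * y} ->
  (forall x, f (fgen x) = g (fgen x)) -> f =1 g.
Proof.
move=> fM gM fg w; elim/free_group_ind: w => [|[x b] w IHw]; first by rewrite !hom1.
by rewrite fM gM IHw; congr (_ * _); case: b; rewrite /fletter //= !homV // fg.
Qed.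

Section RankTwo.
Notation F2 := (Free 2).
Notation x := (fgen (0 : 'I_2)%R).
Notation y := (fgen (1 : 'I_2)%R).

(** Integral 2x2 matrices, row by row; as tuples they are directly accessible to [ring] and
    [lia]. *)
Definition mat2 := (int * int * int * int)%type.

Definition mat2_mul (M N : mat2) : mat2 :=
  let: (a, b, c, d) := M in let: (a', b', c', d') := N in
  (a * a' + b * c', a * b' + b * d', c * a' + d * c', c * b' + d * d')%R.

(** Sanov's matrices with entry 3 instead of 2, which leaves room for the factor 2 in [pingpong]. *)
Definition sanov_letter (a : 'I_2 * bool) : mat2 :=
  let s : int := (if a.2 then -3 else 3)%R in
  if a.1 == 0%R then (1, s, 0, 1)%R else (1, 0, s, 1)%R.

Definition sanov : F2 -> mat2 := word_eval mat2_mul (1, 0, 0, 1)%R sanov_letter.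

Lemma mat2_mulA : associative mat2_mul.
Proof.
by move=> [[[a b] c] d] [[[a' b'] c'] d'] [[[a'' b''] c''] d'']; rewrite /mat2_mul /=; congr (_, _, _, _); ring.
Qed.

Lemma mat2_mul1 : left_id (1, 0, 0, 1)%R mat2_mul.
Proof. by move=> [[[a b] c] d]; rewrite /mat2_mul /=; congr (_, _, _, _); ring. Qed.

Lemma sanov_letterK a M : mat2_mul (sanov_letter a) (mat2_mul (sanov_letter (linv a)) M) = M.
Proof.
case: a M => i s [[[a b] c] d]; rewrite /sanov_letter /=.
by case: ifP; case: s => _; rewrite /mat2_mul /=; congr (_, _, _, _); ring.
Qed.

Lemma sanovM : {morph sanov : u v / u * v >-> mat2_mul u v}.
Proof. exact: word_evalM mat2_mulA mat2_mul1 sanov_letterK. Qed.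

Definition row_sums (M : mat2) : int * int :=
  let: (a, b, c, d) := M in (a + b, c + d)%R.

(* Ping-pong on the vector [(1, 1)]: the first letter of a reduced word
   determines which coordinate dominates, and the sign of their ratio. *)
Definition pingpong (w : seq ('I_2 * bool)) (M : mat2) : Prop :=
  let: (u, v) := row_sums M in
  match w with
  | [::] => u = 1%R /\ v = 1%R
  | (i, s) :: _ =>
    let: (p, q) := if i == 0%R then (u, v) else (v, u) in
    let p' := (if s then - p else p)%R in
    ((0 < q) && (q *+ 2 <= p') || (q < 0) && (p' <= q *+ 2))%R
  end.

Lemma sanov_pingpong (w : F2) : pingpong w (sanov w).
Proof.
case: w => w rw; rewrite /sanov /word_eval /=; elim: w rw => [|[i s] w IHw] rw //=.
have /= := IHw (path_sorted rw); move: (foldr _ _ w) => [[[a b] c] d].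
have i01 (j : 'I_2) : j = 0%R \/ j = 1%R.
  by case: j => [[|[|//]] ?]; [left|right]; apply: val_inj.
case: w rw {IHw} => [|[j t] w] rw; rewrite /pingpong /=.
  move=> [ab cd]; case: (i01 i) => ->; case: s {rw}; rewrite /mat2_mul /=; lia.
have : (j, t) != linv (i, s) by case/andP: rw.
rewrite xpair_eqE /=.
by case: (i01 i) => ->; case: (i01 j) => ->; case: s {rw}; case: t; rewrite /mat2_mul /= => // _; lia.
Qed.

(** Coordinates modulo scalar matrices: two matrices commute exactly when these vectors are
    parallel. *)
Definition traceless (M : mat2) : int * int * int :=
  let: (a, b, c, d) := M in (a - d, b, c)%R.

(** A scalar matrix has equal row sums, whereas for a nonempty word one of them dominates the
    other. *)
Lemma sanov_nonscalar w : w <> 1 -> traceless (sanov w) <> (0, 0, 0)%R.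
Proof.
move=> w1; have := sanov_pingpong w.
have : fg_word w <> [::] by move=> w0; apply: w1; apply: val_inj.
case: (fg_word w) => [//|[i s] t] _; move: (sanov w) => [[[a b] c] d].
rewrite /pingpong /traceless /= => H [ad b0 c0]; move: H; rewrite b0 c0.
by case: (i == 0%R); case: s; lia.
Qed.

Lemma parallel_trans (I : Type) (u v w : I -> int) k : w k <> 0%R ->
  (forall i j, u i * w j = u j * w i)%R -> (forall i j, v i * w j = v j * w i)%R ->
  (forall i j, u i * v j = u j * v i)%R.
Proof.
move=> wk uw vw i j; have {}wk : (w k != 0)%R by apply/eqP.
apply: (GRing.mulIf wk); transitivity (u k * (v j * w i))%R.
  by rewrite [RHS]GRing.mulrCA -uw; ring.
by rewrite vw [LHS]GRing.mulrCA -uw; ring.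
Qed.

Definition traceless_part (M : mat2) (i : nat) : int :=
  let: (a, b, c, d) := M in nth 0%R [:: a - d; b; c]%R i.

Lemma mat2_commuteP U V : mat2_mul U V = mat2_mul V U <->
  forall i j, (traceless_part U i * traceless_part V j = traceless_part U j * traceless_part V i)%R.
Proof.
move: U V => [[[a b] c] d] [[[a' b'] c'] d']; rewrite /mat2_mul /traceless_part.
split=> [[e1 e2 e3 _]|e].
  case=> [|[|[|i]]] [|[|[|j]]] //=; rewrite ?nth_nil ?GRing.mulr0 ?GRing.mul0r //; lia.
have := (e 0%N 1%N, e 0%N 2%N, e 1%N 2%N); rewrite /= => -[[e1 e2] e3].
by congr (_, _, _, _); lia.
Qed.

Lemma mat2_commute_trans U V W : traceless W <> (0, 0, 0)%R ->
  mat2_mul U W = mat2_mul W U -> mat2_mul V W = mat2_mul W V ->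
  mat2_mul U V = mat2_mul V U.
Proof.
move=> W0 /mat2_commuteP UW /mat2_commuteP VW; apply/mat2_commuteP.
suff [k Wk] : exists k, traceless_part W k <> 0%R by apply: parallel_trans Wk UW VW.
apply: contrapT => nW; apply: W0.
have {nW} W0 k : traceless_part W k = 0%R.
  by apply: contrapT => Wk; apply: nW; exists k.
by move: W W0 {UW VW} => [[[a b] c] d] W0; move: (W0 0%N) (W0 1%N) (W0 2%N) => /= -> -> ->.
Qed.

Lemma sanov_inj : injective sanov.
Proof.
move=> u v uv; apply: contrapT => nuv.
have : u * v^-1 <> 1 by move=> /(congr1 (fun z => z * v)); rewrite mulgKV mul1g.
move/sanov_nonscalar; apply.
by rewrite sanovM uv -sanovM mulgV.
Qed.

(** The image of [w] is nonscalar, and being parallel to a given nonzero vector modulo scalars is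
    transitive. Hence a noncommutative subgroup has no nontrivial central element. *)
Lemma free2_commute_trans (u v w : F2) : w <> 1 ->
  u * w = w * u -> v * w = w * v -> u * v = v * u.
Proof.
move=> /sanov_nonscalar w1 uw vw; apply: sanov_inj; rewrite !sanovM.
by apply: mat2_commute_trans w1 _ _; rewrite -!sanovM ?uw ?vw.
Qed.

Definition basis_commutator : F2 := x * y * x^-1 * y^-1.
Notation c := basis_commutator.

Lemma basis_commutator_torsion_free m : c ^+ m.+1 <> 1.
Proof.
(* The word of [c] ends with the inverse of [y], so nothing cancels when it is put before a word
   starting with [x]. *)
suff [s sE] : exists s, fg_word (c ^+ m.+1) = (0%R, false) :: s.
  by move/(congr1 (@fg_word _)); rewrite sE.
elim: m => [|m [s IHm]]; first by eexists; vm_compute.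
rewrite expgS /= IHm; eexists; rewrite /=; reflexivity.
Qed.

(** Transitivity of commutation, applied twice, strips the exponents; for [c] and its conjugate by
    [x], the words are compared by computation. *)
Lemma conj_commutator_power_noncommuting m (d := c ^+ m.+1) :
  d * (x * d * x^-1) <> (x * d * x^-1) * d.
Proof.
have dE : x * d * x^-1 = (x * c * x^-1) ^+ m.+1.
  rewrite /d; elim: (m.+1) => [|k IHk]; first by rewrite !expg0 mulg1 mulgV.
  by rewrite !expgS -IHk !mulgA mulgKV.
have c'1 : (x * c * x^-1) ^+ m.+1 <> 1.
  rewrite -dE => /(congr1 (fun z => x^-1 * z * x)); rewrite !mulgA mulVg mul1g.
  by rewrite -mulgA mulVg !mulg1 mulVg; apply: basis_commutator_torsion_free.
rewrite dE => dd.
have cX (z : F2) k : z * z ^+ k = z ^+ k * z by rewrite -expgS expgSr.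
have cd' : c * (x * c * x^-1) ^+ m.+1 = (x * c * x^-1) ^+ m.+1 * c.
  by apply: (free2_commute_trans (@basis_commutator_torsion_free m)) => //; apply: cX.
have : c * (x * c * x^-1) = (x * c * x^-1) * c.
  by apply: (free2_commute_trans c'1) => //; apply: cX.
by move/(congr1 (@fg_word _)); vm_compute.
Qed.

End RankTwo.
End FreeGroups.

(** * Nonlinearity for [n >= 4] *)

Section NonLinear.
Local Open Scope group_scope.

Section Elementary.
Variables (n : nat) (i : 'I_n).

(** With the inverse of [u], composition follows the order of products: [v^-1 f_i] is sent to
    [v^-1 u^-1 f_i = (u v)^-1 f_i]. *)
Definition elem_map (u : Free n) : Free n -> Free n :=
  flift (fun j => if j == i then u^-1 * fgen i else fgen j).

Lemma elem_map_gen u j : elem_map u (fgen j) = if j == i then u^-1 * fgen i else fgen j.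
Proof. exact: flift_gen. Qed.

Lemma elem_mapM u : {morph elem_map u : x y / x * y}.
Proof. exact: fliftM. Qed.

Lemma elem_map1 u : elem_map u 1 = 1.
Proof. by []. Qed.

Lemma elem_mapV u : {morph elem_map u : x / x^-1}.
Proof. exact: fliftV. Qed.

Lemma elem_map_fix u w : Fsub i w -> elem_map u w = w.
Proof.
move: w; apply: smallest_sub.
  split=> [|x y /= ux uy|x /= ux]; first exact: flift1.
    by rewrite elem_mapM ux uy.
  by rewrite elem_mapV ux.
move=> _ [j /= ji <-]; rewrite elem_map_gen; case: eqP => // ji'.
by rewrite ji' ltnn in ji.
Qed.

Lemma elem_mapK u : Fsub i u -> cancel (elem_map u) (elem_map u^-1).
Proof.
move=> Fu; apply: (@free_hom_eq _ _ (elem_map u^-1 \o elem_map u) id) => //.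
  by move=> x y; rewrite /= !elem_mapM.
move=> j /=; rewrite elem_map_gen; case: (eqVneq j i) => [->|ji].
  rewrite elem_mapM elem_map_gen eqxx invgK elem_map_fix ?mulKg //.
  by have [_ _] := Fsub_subgroup n i; apply.
by rewrite elem_map_gen (negPf ji).
Qed.

Lemma elem_mapKV u : Fsub i u -> cancel (elem_map u^-1) (elem_map u).
Proof.
move=> Fu; rewrite -{2}[u]invgK; apply: elem_mapK.
by have [_ _] := Fsub_subgroup n i; apply.
Qed.

Definition elem_aut u (Fu : Fsub i u) : aut (Free n) :=
  Aut (elem_mapM u) (elem_mapK Fu) (elem_mapKV Fu).

Fact elem_unitri u (Fu : Fsub i u) : elem_aut Fu \in @unitri n.
Proof.
apply/asboolP/unitriangularE => j /=; rewrite elem_map_gen.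
case: (eqVneq j i) => [->|ji].
  by exists u^-1 => //; have [_ _] := Fsub_subgroup n i; apply.
by exists 1; rewrite ?mul1g //; have [] := Fsub_subgroup n j.
Qed.

Definition elem u (Fu : Fsub i u) : Un n := UnAut (elem_unitri Fu).

Lemma elem_gen u (Fu : Fsub i u) j :
  (elem Fu : aut (Free n)) (fgen j) = if j == i then u^-1 * fgen i else fgen j.
Proof. exact: elem_map_gen. Qed.

Lemma elem_fix u (Fu : Fsub i u) w : Fsub i w -> (elem Fu : aut (Free n)) w = w.
Proof. exact: elem_map_fix. Qed.

End Elementary.

Lemma Un_eq n (f g : Un n) : (forall j, f (fgen j) = g (fgen j)) -> f = g.
Proof.
move=> fg; apply: val_inj; apply: autP.
by apply: free_hom_eq => //; apply: autM.
Qed.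

Lemma UnM n (f g : Un n) w : (f * g) w = f (g w).
Proof. by []. Qed.

Section InclusionF2.
Variables (n : nat) (n2 : 2 <= n).

Definition incl2 : Free 2 -> Free n := flift (fun j => fgen (widen_ord n2 j)).

Lemma incl2M : {morph incl2 : x y / x * y}. Proof. exact: fliftM. Qed.

Lemma incl2_Fsub m w : 2 <= m -> Fsub m (incl2 w).
Proof.
move=> m2; have [F1 FM FV] := Fsub_subgroup n m.
elim/free_group_ind: w => [|[j b] w Fw]; first exact: F1.
rewrite incl2M; apply: FM => //.
have Fj : Fsub m (incl2 (fgen j)).
  by rewrite /incl2 flift_gen; apply: Fsub_gen; apply: leq_trans m2; apply: (ltn_ord j).
by case: b; rewrite /fletter //= /incl2 fliftV; apply: FV.
Qed.

Lemma incl2_inj : injective incl2.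
Proof.
pose r : Free n -> Free 2 := flift (fun j : 'I_n => fgen (inord j : 'I_2)).
apply: (can_inj (g := r)); apply: (@free_hom_eq _ _ (r \o incl2) id) => //.
  by move=> x y; rewrite /= incl2M /r fliftM.
move=> j /=; rewrite /incl2 flift_gen /r flift_gen; congr fgen.
by apply: val_inj; rewrite /= inordK.
Qed.

End InclusionF2.

Lemma Formanek_Procesi_relations n : 4 <= n -> exists (A B : Free 2 -> Un n) (t : Un n),
  [/\ {morph A : x y / x * y}, injective A,
      forall v w, A v * B w = B w * A v
    & forall w, A w * B w * t = t * B w].
Proof.
move=> n4; have n2 : 2 <= n by apply: leq_trans n4.
pose i3 : 'I_n := Ordinal n4; pose i2 : 'I_n := Ordinal (ltnW n4).
have F2 w : Fsub i2 (incl2 n2 w) by apply: incl2_Fsub.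
have F3 w : Fsub i3 (incl2 n2 w) by apply: incl2_Fsub.
(* The conjugator [t] sends [f_4] to [f_3^-1 f_4]. On that image, [B w] inserts a factor [w] before
   [f_4], which [A w] cancels. *)
have Ft : Fsub i3 (fgen i2) by apply: Fsub_gen.
exists (fun w => elem (F3 w)), (fun w => elem (F2 w)), (elem Ft).
have i23 : i2 == i3 = false by [].
have i32 : i3 == i2 = false by [].
have F31 w : Fsub i3 (incl2 n2 w)^-1.
  by have [_ _] := Fsub_subgroup n i3; apply.
have F21 w : Fsub i2 (incl2 n2 w)^-1.
  by have [_ _] := Fsub_subgroup n i2; apply.
split.
- move=> v w; apply: Un_eq => j; rewrite UnM !elem_gen.
  case: (eqVneq j i3) => [ji|ji]; rewrite ?ji; last by rewrite elem_gen (negPf ji).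
  by rewrite autM elem_gen eqxx elem_fix // incl2M invgM mulgA.
- move=> v w /(congr1 (fun f : Un n => f (fgen i3))); rewrite !elem_gen eqxx.
  by move/mulIg/invg_inj; apply: incl2_inj.
- move=> v w; apply: Un_eq => j; rewrite !UnM.
  rewrite (elem_gen (F2 w) j) (elem_gen (F3 v) j).
  case: (eqVneq j i2) => [ji|j2]; rewrite ?ji.
    by rewrite i23 autM (elem_fix _ (F31 w)) !elem_gen i23 eqxx.
  case: (eqVneq j i3) => [ji|j3]; rewrite ?ji; last by rewrite !elem_gen (negPf j2) (negPf j3).
  by rewrite autM (elem_fix _ (F21 v)) !elem_gen i32 eqxx.
- move=> w; apply: Un_eq => j; rewrite !UnM !elem_gen.
  case: (eqVneq j i3) => [ji|j3]; rewrite ?ji.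
    rewrite /= !(elem_mapM, elem_mapV, elem_map_gen) /= ?eqxx.
    rewrite !(elem_map_fix _ (F3 w)) elem_map1 mulg1 invgM invgK !mulgA.
    by rewrite mulgK.
  case: (eqVneq j i2) => [ji|j2]; rewrite ?ji; last by rewrite !elem_gen (negPf j3) (negPf j2) !elem_gen (negPf j3).
  rewrite /= !(elem_mapM, elem_mapV, elem_map_gen) /= ?eqxx.
  by rewrite !(elem_map_fix _ (F3 w)).
Qed.

Section CharTrivial.
Variable G : groupType.

(** All fields are allowed because the eigenvalues live in an extension that depends on the
    matrices. *)
Definition all_char_trivial (g : G) := forall L : fieldType, char_trivial L g.

Import GRing.Theory.
Local Open Scope ring_scope.

Lemma all_char_trivial1 : all_char_trivial 1%g.
Proof. by move=> L chi. Qed.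

Lemma all_char_trivialM g h :
  all_char_trivial g -> all_char_trivial h -> all_char_trivial (g * h)%g.
Proof. by move=> gt ht L chi cM c1; rewrite cM gt // ht // mulr1. Qed.

Lemma all_char_trivialV g : all_char_trivial g -> all_char_trivial g^-1%g.
Proof.
move=> gt L chi cM c1.
by have := cM g^-1%g g; rewrite mulVg c1 (gt L chi cM c1) mulr1 => <-.
Qed.

Lemma all_char_trivialX g m : all_char_trivial g -> all_char_trivial (g ^+ m)%g.
Proof.
move=> gt; elim: m => [|m IHm]; first exact: all_char_trivial1.
by rewrite expgS; apply: all_char_trivialM.
Qed.

Lemma all_char_trivialJ g h : all_char_trivial g -> all_char_trivial (h * g * h^-1)%g.
Proof.
by move=> gt L chi cM c1; rewrite !cM (gt L) // mulr1 -cM mulgV.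
Qed.

Lemma all_char_trivialR g h : all_char_trivial (g * h * g^-1 * h^-1)%g.
Proof.
move=> L chi cM c1; rewrite !cM [chi g * chi h]mulrC -[_ * chi g * _]mulrA.
by rewrite -cM mulgV c1 mulr1 -cM mulgV.
Qed.

End CharTrivial.

Import GRing.Theory.
Local Open Scope ring_scope.

(** * Contradiction from a representation of the Formanek-Procesi relations *)

Section Representation.
Variables (K : fieldType) (d : nat) (A B : Free 2 -> 'M[K]_d.+1) (T : 'M[K]_d.+1).
Hypotheses (AM : {morph A : v w / (v * w)%g >-> v * w}) (A1 : A 1%g = 1).
Hypotheses (A_inj : forall g, A g = 1 -> g = 1%g).
Hypotheses (AB : forall v w, A v * B w = B w * A v) (Bu : forall w, B w \in unitmx).
Hypotheses (Tu : T \in unitmx) (ABT : forall w, A w * B w * T = T * B w).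

Notation c := basis_commutator.

Let AX g m : A (g ^+ m)%g = A g ^+ m.
Proof. by elim: m => [|m IHm]; rewrite ?A1 // expgS exprS AM IHm. Qed.

Let c_trivial : all_char_trivial c. Proof. exact: all_char_trivialR. Qed.

Let power g : all_char_trivial g ->
  exists2 N, (0 < N)%N & (A g ^+ N - 1) ^+ d.+1 = 0.
Proof.
move=> gt; apply: commuting_unipotent_power gt AM A1 _ (Bu g) Tu (ABT g) => h.
exact: AB.
Qed.

(** In characteristic [p], raising the unipotent matrix [A c ^+ N] to a large power of [p] gives 1,
    whereas [c] has infinite order. *)
Let not_pchar p : p \in [pchar K] -> False.
Proof.
move=> pK; have [N N0 AN] := power c_trivial.
have pp := pcharf_prime pK.
have [W] := matrix_freshman d.+1 (A c ^+ N - 1) pp.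
have p0 : p%:R = 0 :> 'M[K]_d.+1.
  by rewrite -[p%:R](scaler_nat p 1) (pcharf0 pK) scale0r.
rewrite p0 mul0r addr0 addrC subrK.
rewrite -(subnK (ltnW (ltn_expl d.+1 (prime_gt1 pp)))) [in RHS]exprD AN mulr0 addr0.
rewrite subnK ?(ltnW (ltn_expl _ (prime_gt1 pp))) // -exprM -AX => /A_inj.
have : (0 < N * p ^ d.+1)%N by rewrite muln_gt0 N0 expn_gt0 prime_gt0.
by case: (N * _)%N => // m _; apply: basis_commutator_torsion_free.
Qed.

Section CharZero.
Hypothesis K0 : [pchar K] =i pred0.
Variables (R : comNzRingType) (ev : {rmorphism R -> K}).
Hypothesis A_int : forall g, exists A0, A g = map_mx ev A0.

Definition congruent1 p (M : 'M[K]_d.+1) := exists Y, M = 1 + p%:R * map_mx ev Y.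

Let congruent1E p M : congruent1 p M <->
  exists2 M0, M = map_mx ev M0 & eq_mod p M0 1.
Proof.
split=> [[Y ->]|[M0 -> [Y ->]]].
  exists (1 + p%:R * Y); last by exists Y.
  by rewrite rmorphD rmorphM rmorph1 rmorph_nat.
by exists Y; rewrite rmorphD rmorphM rmorph1 rmorph_nat.
Qed.

Let congruent1M p M N : congruent1 p M -> congruent1 p N -> congruent1 p (M * N).
Proof.
move=> /congruent1E[M0 -> M1] /congruent1E[N0 -> N1]; apply/congruent1E.
exists (M0 * N0); first by rewrite rmorphM.
by rewrite -[1]mulr1; apply: eq_modM.
Qed.

Let congruent1X p M m : congruent1 p M -> congruent1 p (M ^+ m).
Proof.
move=> /congruent1E[M0 -> M1]; apply/congruent1E.
exists (M0 ^+ m); first by rewrite rmorphXn.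
by rewrite -[1](expr1n _ m); apply: eq_mod_exp.
Qed.

Let congruent1J p g h : congruent1 p (A g) -> congruent1 p (A (h * g * h^-1)%g).
Proof.
have [H HE] := A_int h; have [H' HE'] := A_int h^-1%g.
move=> [Y gE]; exists (H * Y * H').
rewrite !AM gE mulrDr mulr1 mulrDl -AM mulgV A1 HE HE'.
have pC : map_mx ev H * p%:R = p%:R * map_mx ev H := commr_nat _ _.
by rewrite !rmorphM /= mulrA pC -!mulrA.
Qed.

Let congruent1V p g : congruent1 p (A g) -> congruent1 p (A g^-1%g).
Proof.
have [H HE] := A_int g^-1%g.
move=> [Y gE]; exists (- (H * Y)).
have : A g^-1%g * A g = 1 by rewrite -AM mulVg A1.
rewrite gE mulrDr mulr1 => /(canRL (addrK _)) ->.
have pC : map_mx ev H * p%:R = p%:R * map_mx ev H := commr_nat _ _.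
by rewrite HE rmorphN rmorphM /= mulrN mulrA pC -mulrA.
Qed.

Variables p q : nat.
Hypotheses (p_prime : prime p) (q_prime : prime q) (pq : p != q).
Hypotheses (p_noninv : forall r, 1 <> p%:R * ev r) (q_noninv : forall r, 1 <> q%:R * ev r).

Definition unipotent_part : set (Free 2) :=
  [set g | [/\ all_char_trivial g, congruent1 p (A g) & congruent1 q (A g)]].

Let unipotent_part_subgroup : is_subgroup unipotent_part.
Proof.
split.
- by split; [exact: all_char_trivial1|rewrite A1; exists 0; rewrite rmorph0 mulr0 addr0..].
- move=> g h [g1 gp gq] [h1 hp hq].
  by split; [exact: all_char_trivialM|rewrite AM; apply: congruent1M..].
- by move=> g [g1 gp gq]; split; [exact: all_char_trivialV|apply: congruent1V..].
Qed.

(** Write the exponent [N] of [power] as [m * p ^ l] with [m] prime to [p]. The congruence modulo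
    [p] removes [m], and the one modulo [q] removes [p ^ l]. *)
Let unipotent_part_unipotent g : unipotent_part g -> exists k, (A g - 1) ^+ k = 0.
Proof.
move=> [g1 gp gq]; have [N N0 AN] := power g1; exists d.+1.
have [m pm NE] := pfactor_coprime p_prime N0.
move: NE AN; move: (logn p N) => l -> AN.
have [Y YE] := congruent1X (p ^ l) gp.
have Al : (A g ^+ (p ^ l) - 1) ^+ d.+1 = 0.
  by apply: (coprime_unipotent p_noninv pm YE); rewrite -exprM mulnC.
have [Z ZE] := gq; apply: (coprime_unipotent q_noninv _ ZE Al).
by rewrite coprimeXr // prime_coprime // dvdn_prime2 // eq_sym.
Qed.

(** A power of [A c] is unipotent; further powers make it congruent to 1 modulo [p] and modulo [q],
    and the exponents are multiplied. *)
Let commutator_power : exists m, unipotent_part (c ^+ m.+1)%g.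
Proof.
have [N N0 AN] := power c_trivial.
have [A0 A0E] := A_int (c ^+ N)%g.
rewrite -AX in AN.
have [u u0 up] := unipotent_eq_mod p_prime A0E AN.
have [v v0 vq] := unipotent_eq_mod q_prime A0E AN.
have : (0 < N * (u * v))%N by rewrite !muln_gt0 N0 u0.
case E: (N * (u * v))%N => [//|m] _; exists m; rewrite -E.
split; first exact: all_char_trivialX.
  by rewrite expgM AX exprM; apply: congruent1X.
by rewrite expgM AX mulnC exprM; apply: congruent1X.
Qed.

(** The unipotent part contains a power of [c] and its conjugate by [x]. A nontrivial central
    element would commute with both, so they would commute. *)
Lemma char_zero_contradiction : False.
Proof.
have [m cm] := commutator_power.
set e := (c ^+ m.+1)%g in cm.
pose x := fgen (0 : 'I_2).
have cm' : unipotent_part (x * e * x^-1)%g.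
  have [e1 ep eq] := cm; split; [exact: all_char_trivialJ|exact: congruent1J..].
have [|z [zu z1 zc]] := unipotent_group_center K0 unipotent_part_subgroup AM A1 A_inj unipotent_part_unipotent.
  by exists e => //; apply: basis_commutator_torsion_free.
apply: (@conj_commutator_power_noncommuting m).
by apply: (free2_commute_trans z1); rewrite zc.
Qed.

End CharZero.

Lemma Formanek_Procesi_no_representation : False.
Proof.
have K0 : [pchar K] =i pred0 by move=> p; apply/negP => /not_pchar.
(* Letters include inverses of generators, so the ring generated by these entries contains the
   entries of every [A g]. *)
pose xs := codom (fun t : ('I_2 * bool) * 'I_d.+1 * 'I_d.+1 =>
  A (fletter t.1.1) t.1.2 t.2).
have [R [ev [evp evx]]] := finitely_generated_few_primes xs K0.
have A_int g : exists A0, A g = map_mx ev A0.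
  elim/free_group_ind: g => [|a w [W WE]].
    by exists 1; rewrite A1 rmorph1.
  have /choice[f fE] (t : 'I_d.+1 * 'I_d.+1) : exists r, A (fletter a) t.1 t.2 = ev r.
    by apply: evx; apply: (codom_f _ (a, t.1, t.2)).
  exists ((\matrix_(i, j) f (i, j)) * W); rewrite AM WE rmorphM; congr (_ * _).
  by apply/matrixP => i j; rewrite !mxE -fE.
(* At [s = 1] with exponent 0, the property says that a prime not dividing [D] is not invertible;
   two primes above [D] are chosen. *)
have [|D D0 HD] := evp 1; first by rewrite rmorph1 oner_neq0.
have [p Dp pp] := prime_above D; have [q pq qq] := prime_above p.
have noninv r' : prime r' -> (D < r')%N -> forall r, 1 <> r'%:R * ev r.
  move=> r'p Dr r; apply: (HD r' r'p _ 0%N r).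
  by rewrite gtnNdvd.
apply: (@char_zero_contradiction K0 R ev A_int p q pp qq).
- by rewrite neq_ltn pq.
- exact: noninv.
- by apply: noninv => //; apply: ltn_trans pq.
Qed.

End Representation.

Lemma Un_nonlinear n : (4 <= n)%N -> ~ linear_group (Un n).
Proof.
move=> n4 [K [[|d] [rho [// _ rhou rhoM rho_inj]]]].
have [A [B [t [AM A_inj AB ABt]]]] := Formanek_Procesi_relations n4.
have rhoM' x y : rho (x * y)%g = rho x * rho y by rewrite rhoM.
have rho1 : rho 1%g = 1.
  by apply: (mulrI (rhou 1%g : rho 1%g \is a GRing.unit)); rewrite mulr1 -rhoM' mulg1.
have A1 : A 1%g = 1%g by apply: (mulgI (A 1%g)); rewrite -AM !mulg1.
apply: (@Formanek_Procesi_no_representation K d (rho \o A) (rho \o B) (rho t)).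
- by move=> x y /=; rewrite AM rhoM'.
- by rewrite /= A1.
- by move=> g /=; rewrite -rho1 => /rho_inj; rewrite -A1 => /A_inj.
- by move=> v w /=; rewrite -!rhoM' AB.
- by move=> w /=; apply: rhou.
- exact: rhou.
- by move=> w /=; rewrite -!rhoM' ABt.
Qed.

End NonLinear.

(** * Linearity for [n <= 3] *)

Section LinearPart.
Import Order.TTheory GRing.Theory Num.Theory.
Local Open Scope ring_scope.

Lemma Fsub_letters n m (w : Free n) : Fsub m w -> all (fun a : 'I_n * bool => (a.1 < m)%N) (fg_word w).
Proof.
pose P : set (Free n) := fun w => all (fun a : 'I_n * bool => (a.1 < m)%N) (fg_word w).
have push_all (a : 'I_n * bool) s :
    (a.1 < m)%N -> all (fun a : 'I_n * bool => (a.1 < m)%N) s -> all (fun a : 'I_n * bool => (a.1 < m)%N) (push a s).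
  by case: s => [|b s] /= am; [rewrite am|case: ifP => _ /=; [case/andP|rewrite am]].
suff : (Fsub m `<=` P)%classic by apply.
apply: smallest_sub.
  split=> // [x y /= Px Py|x /= Px].
    by move: Px; rewrite /P /= /wmul; elim: (fg_word x) => //= a s IHs /andP[am /IHs]; apply: push_all.
  by rewrite /P /= /winv all_rev all_map.
by move=> _ [j /= jm <-]; rewrite /P /= andbT.
Qed.

Section Matrices.
Variable F : fieldType.

Definition mat3 (a b c d e f g h i : F) : 'M[F]_3 :=
  \matrix_(k, l) nth 0 (nth [::] [:: [:: a; b; c]; [:: d; e; f]; [:: g; h; i]] k) l.

Definition col3 (a b c : F) : 'cV[F]_3 := \col_k nth 0 [:: a; b; c] k.

Lemma mat3_mul a b c d e f g h i a' b' c' d' e' f' g' h' i' :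
  mat3 a b c d e f g h i *m mat3 a' b' c' d' e' f' g' h' i' =
  mat3 (a * a' + b * d' + c * g') (a * b' + b * e' + c * h') (a * c' + b * f' + c * i')
       (d * a' + e * d' + f * g') (d * b' + e * e' + f * h') (d * c' + e * f' + f * i')
       (g * a' + h * d' + i * g') (g * b' + h * e' + i * h') (g * c' + h * f' + i * i').
Proof.
apply/matrixP => k l; rewrite !mxE !big_ord_recr big_ord0 !mxE /= add0r.
by case: k => [[|[|[|//]]] ?]; case: l => [[|[|[|//]]] ?].
Qed.

Lemma mat3_mul_col a b c d e f g h i x y z :
  mat3 a b c d e f g h i *m col3 x y z =
  col3 (a * x + b * y + c * z) (d * x + e * y + f * z) (g * x + h * y + i * z).
Proof.
apply/matrixP => k l; rewrite !mxE !big_ord_recr big_ord0 !mxE /= add0r.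
by case: k => [[|[|[|//]]] ?].
Qed.

Lemma mat3_1 : mat3 1 0 0 0 1 0 0 0 1 = 1%:M.
Proof.
by apply/matrixP => k l; rewrite !mxE; case: k => [[|[|[|//]]] ?]; case: l => [[|[|[|//]]] ?].
Qed.

Lemma scale_col3 a x y z : a *: col3 x y z = col3 (a * x) (a * y) (a * z).
Proof.
by apply/matrixP => i j; rewrite !mxE; case: i => [[|[|[|//]]] ?].
Qed.

Lemma col3_inj a b c a' b' c' : col3 a b c = col3 a' b' c' -> [/\ a = a', b = b' & c = c'].
Proof.
move=> /matrixP e.
by split; [have := e 0 0|have := e 1 0|have := e 2%:R 0]; rewrite !mxE.
Qed.

(** For [e] a power of 2, [diagX e] represents a power of [f_1], and [diagQ e] the automorphism
    multiplying [f_2] by that power. *)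
Definition diagX (e : F) := mat3 1 0 0 0 e 0 0 0 e^-1.
Definition diagQ (e : F) := mat3 1 0 0 0 e 0 0 0 1.

Lemma diagX_mul e e' : e != 0 -> e' != 0 -> diagX e *m diagX e' = diagX (e * e').
Proof.
by move=> e0 e0'; rewrite mat3_mul /diagX; congr mat3; field; rewrite ?e0 ?e0'.
Qed.

Lemma diagQ_mul e e' : diagQ e *m diagQ e' = diagQ (e * e').
Proof. by rewrite mat3_mul /diagQ; congr mat3; ring. Qed.

Lemma diagXQ e e' : diagX e *m diagQ e' = diagQ e' *m diagX e.
Proof. by rewrite !mat3_mul; congr mat3; ring. Qed.

Variable t : F.
Hypotheses (t0 : t != 0) (two0 : 2%:R != 0 :> F).

Definition matY := mat3 (t + t^-1) 0 (t - t^-1) (t - t^-1) 0 (t + t^-1) 0 1 0.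
Definition matYV := mat3 ((t^-1 + t) / 4%:R) ((t^-1 - t) / 4%:R) 0 0 0 1
  ((t^-1 - t) / 4%:R) ((t^-1 + t) / 4%:R) 0.

Let four0 : 4%:R != 0 :> F. Proof. by rewrite -[4%N]/(2 * 2)%N natrM mulf_neq0. Qed.

Lemma matYK : matY *m matYV = 1%:M.
Proof.
by rewrite mat3_mul -mat3_1; congr mat3; field; rewrite ?t0 ?four0 ?two0.
Qed.

Lemma matYVK : matYV *m matY = 1%:M.
Proof. exact: mulmx1C matYK. Qed.

(** Conjugation by [diagQ e] takes [matY] to [diagX e *m matY], as the automorphism does with
    [f_2]. *)
Lemma diagX_matY e : e != 0 -> diagX e *m matY *m diagQ e = diagQ e *m matY.
Proof.
by move=> e0; rewrite !mat3_mul; congr mat3; field; rewrite ?e0 ?t0.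
Qed.

Definition lin_letter (k : nat) (b : bool) : 'M[F]_3 :=
  match k with
  | 0 => diagX (if b then 2%:R^-1 else 2%:R)
  | 1 => if b then matYV else matY
  | _ => 1%:M
  end.

Definition twist_letter (k : nat) (b : bool) : 'M[F]_3 :=
  if k is 0 then diagQ (if b then 2%:R^-1 else 2%:R) else 1%:M.

(** In this and the next three lemmas a common denominator is set apart, so that the numerators
    remain polynomials in [t]. *)
Lemma lin_letter_X_col D x y z : D != 0 ->
  lin_letter 0 false *m (D^-1 *: col3 x y z) =
  (2%:R * D)^-1 *: col3 (2%:R * x) (4%:R * y) z.
Proof.
move=> D0; rewrite /= -scalemxAr mat3_mul_col !scale_col3.
by congr col3; field; rewrite ?D0 ?two0.
Qed.

Lemma lin_letter_XV_col D x y z : D != 0 ->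
  lin_letter 0 true *m (D^-1 *: col3 x y z) =
  (2%:R * D)^-1 *: col3 (2%:R * x) y (4%:R * z).
Proof.
move=> D0; rewrite /= /diagX invrK -scalemxAr mat3_mul_col !scale_col3.
by congr col3; field; rewrite ?D0 ?two0.
Qed.

Lemma lin_letter_Y_col D x y z : D != 0 ->
  lin_letter 1 false *m (D^-1 *: col3 x y z) =
  (1%:R * (t * D))^-1 *: col3 ((t ^+ 2 + 1) * x + (t ^+ 2 - 1) * z)
    ((t ^+ 2 - 1) * x + (t ^+ 2 + 1) * z) (t * y).
Proof.
move=> D0; rewrite /= -scalemxAr mat3_mul_col !scale_col3.
by congr col3; field; rewrite ?D0 ?t0.
Qed.

Lemma lin_letter_YV_col D x y z : D != 0 ->
  lin_letter 1 true *m (D^-1 *: col3 x y z) =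
  (4%:R * (t * D))^-1 *: col3 ((1 + t ^+ 2) * x + (1 - t ^+ 2) * y)
    (4%:R * (t * z)) ((1 - t ^+ 2) * x + (1 + t ^+ 2) * y).
Proof.
move=> D0; rewrite /= -scalemxAr mat3_mul_col !scale_col3.
by congr col3; field; rewrite ?D0 ?t0 ?four0 ?two0.
Qed.

Lemma lin_letterK k b : lin_letter k b *m lin_letter k (~~ b) = 1%:M.
Proof.
case: k => [|[|k]] /=; last exact: mulmx1.
  by case: b; rewrite diagX_mul ?invr_eq0 // ?mulVf ?mulfV // /diagX invr1 mat3_1.
by case: b; rewrite ?matYK ?matYVK.
Qed.

Lemma twist_letterK k b : twist_letter k b *m twist_letter k (~~ b) = 1%:M.
Proof.
case: k => [|k] /=; last exact: mulmx1.
by case: b; rewrite diagQ_mul ?mulVf ?mulfV // /diagQ mat3_1.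
Qed.

Section Reps.
Variable n : nat.

Definition lin_rep : Free n -> 'M[F]_3 :=
  word_eval (fun M N => M *m N) 1%:M (fun a : 'I_n * bool => lin_letter a.1 a.2).
Definition twist_rep : Free n -> 'M[F]_3 :=
  word_eval (fun M N => M *m N) 1%:M (fun a : 'I_n * bool => twist_letter a.1 a.2).

Lemma lin_repM : {morph lin_rep : v w / (v * w)%g >-> v *m w}.
Proof.
apply: word_evalM => [M N P|M|[k b] M]; rewrite ?mulmxA ?mul1mx //.
by rewrite /linv /= lin_letterK mul1mx.
Qed.

Lemma twist_repM : {morph twist_rep : v w / (v * w)%g >-> v *m w}.
Proof.
apply: word_evalM => [M N P|M|[k b] M]; rewrite ?mulmxA ?mul1mx //.
by rewrite /linv /= twist_letterK mul1mx.
Qed.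

Definition two_pow (s : bool) (k : nat) : F := (if s then 2%:R^-1 else 2%:R) ^+ k.

Lemma two_pow_neq0 s k : two_pow s k != 0.
Proof. by rewrite expf_neq0 //; case: s; rewrite ?invr_eq0. Qed.

(** In a reduced word on [f_1] alone all letters are equal, so [k] is its length and [s] the sign of
    its letters. *)
Lemma rank1_image (u : Free n) :
  all (fun a : 'I_n * bool => (a.1 < 1)%N) (fg_word u) -> exists k s,
  [/\ lin_rep u = diagX (two_pow s k), twist_rep u = diagQ (two_pow s k)
    & k = 0%N -> u = 1%g].
Proof.
case: u => w rw /= w1.
rewrite /lin_rep /twist_rep /word_eval /=.
suff [s [e1 e2 _]] : exists s, [/\
    foldr (fun a : 'I_n * bool => mulmx (lin_letter a.1 a.2)) 1%:M w = diagX (two_pow s (size w)),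
    foldr (fun a : 'I_n * bool => mulmx (twist_letter a.1 a.2)) 1%:M w = diagQ (two_pow s (size w))
    & forall a w', w = a :: w' -> a.2 = s].
  by exists (size w), s; split=> // /size0nil w0; apply: val_inj.
elim: w rw w1 => [|a w IHw] rw w1.
  by exists true; rewrite /two_pow expr0 /diagX /diagQ invr1 mat3_1.
have /andP[a1 w1'] := w1; have [s [e1 e2 sE]] := IHw (path_sorted rw) w1'.
have a0 : (a.1 : nat) = 0%N by case: (a.1 : nat) a1.
have ek : two_pow s (size w) = two_pow a.2 (size w).
  case: w rw w1' sE {IHw e1 e2 w1} => [|b w] rw w1 sE; first by rewrite /two_pow !expr0.
  congr two_pow; rewrite -(sE _ _ erefl).
  have /andP[b0 _] := w1; have /andP[ba _] := rw.
  have ab : a.1 = b.1 by apply: val_inj; move: a0 b0 => /= ->; case: (b.1 : nat).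
  by case: a b ab ba {rw w1 sE a1 a0 b0} => [i []] [j []] /= -> ; rewrite /linv /= ?eqxx.
have zE : (if a.2 then 2%:R^-1 else 2%:R) * two_pow a.2 (size w) = two_pow a.2 (size w).+1.
  by rewrite /two_pow exprS.
exists a.2; rewrite /= a0 e1 e2 ek /= diagX_mul ?two_pow_neq0 ?diagQ_mul ?zE //.
  by split=> // b w' [<- _].
by case: (a.2); rewrite ?invr_eq0.
Qed.

(** The value 1 beyond the rank lets the ranks below 3 be treated uniformly. *)
Definition basis_elt (k : nat) : Free n := oapp (@fgen _) 1%g (insub k : option 'I_n).

Lemma basis_elt_ord (j : 'I_n) : basis_elt j = fgen j.
Proof. by rewrite /basis_elt valK. Qed.

Lemma unitri_basis (phi : Un n) k : exists2 u, Fsub k u & phi (basis_elt k) = (u * basis_elt k)%g.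
Proof.
rewrite /basis_elt; case: insubP => [i _ <-|_] /=.
  by have /asboolP/unitriangularE/(_ i) := un_unitri phi.
by exists 1%g; rewrite ?aut1 ?mulg1 //; have [] := Fsub_subgroup n k.
Qed.

Lemma twist_basis1 : twist_rep (basis_elt 1) = 1%:M.
Proof.
rewrite /basis_elt; case: insubP => [i _ i1|_] //=.
by rewrite /twist_rep /word_eval /= mulmx1 i1.
Qed.

Lemma Un_fix1 (phi : Un n) w : Fsub 1 w -> phi w = w.
Proof.
move: w; apply: smallest_sub.
  split=> [|x y /= xf yf|x /= xf]; first exact: aut1.
    by rewrite autM xf yf.
  by rewrite autV xf.
move=> _ [j /= j0 <-]; have /asboolP/(_ j) := un_unitri phi.
by case: (j : nat) j0.
Qed.

Lemma Fsub1_image (u : Free n) : Fsub 1 u -> exists k s,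
  [/\ lin_rep u = diagX (two_pow s k), twist_rep u = diagQ (two_pow s k)
    & k = 0%N -> u = 1%g].
Proof. by move/Fsub_letters/rank1_image. Qed.

(** On the subgroup generated by [f_1] and [f_2], [phi] fixes [f_1] and multiplies [f_2] by a power
    of [f_1]; a diagonal matrix [diagQ] realizes this by conjugation. *)
Lemma Un_twist (phi : Un n) w : Fsub 2 w ->
  lin_rep (phi w) *m twist_rep (phi (basis_elt 1)) =
  twist_rep (phi (basis_elt 1)) *m lin_rep w.
Proof.
have [u Fu uE] := unitri_basis phi 1.
have [k [s [lu tu _]]] := Fsub1_image Fu.
rewrite uE twist_repM twist_basis1 mulmx1 tu; set q := diagQ _.
move: w; apply: smallest_sub.
  split=> [|x y /= xf yf|x /= xf].
  - by rewrite aut1 mul1mx mulmx1.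
  - by rewrite autM !lin_repM -mulmxA yf mulmxA xf mulmxA.
  - have V (z : Free n) : lin_rep z *m lin_rep z^-1%g = 1%:M by rewrite -lin_repM mulgV.
    have V' (z : Free n) : lin_rep z^-1%g *m lin_rep z = 1%:M by rewrite -lin_repM mulVg.
    rewrite autV -[LHS]mulmx1 -(V x) mulmxA -[_ *m q *m _]mulmxA -xf.
    by rewrite mulmxA V' mul1mx.
move=> _ [j /= j2 <-]; case: (posnP j) => [j0|j0].
  have -> : phi (fgen j) = fgen j.
    by apply: Un_fix1; apply: Fsub_gen; rewrite j0.
  by rewrite /lin_rep /word_eval /= mulmx1 j0 /=; apply: diagXQ.
have j1 : (j : nat) = 1%N by apply/eqP; rewrite eqn_leq j0 -ltnS j2.
have ej : basis_elt 1 = fgen j by rewrite -j1 basis_elt_ord.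
rewrite -ej uE lin_repM lu ej.
rewrite /lin_rep /word_eval /= mulmx1 j1 /=; apply: diagX_matY.
exact: two_pow_neq0.
Qed.

(** If [phi] sends [f_3] to [u f_3], the argument of [lin_rep] is [u^-1], here expressed without
    choosing [u]. The formula reflects a semidirect product of [F_2] with the action on [f_2]. *)
Definition Un_rep (phi : Un n) : 'M[F]_3 :=
  lin_rep (basis_elt 2 * (phi (basis_elt 2))^-1)%g *m twist_rep (phi (basis_elt 1)).

Lemma Un_repM : {morph Un_rep : x y / (x * y)%g >-> x *m y}.
Proof.
move=> phi psi; rewrite /Un_rep !UnM.
have [v Fv vE] := unitri_basis psi 2; have [u Fu uE] := unitri_basis phi 2.
have [v1 Fv1 v1E] := unitri_basis psi 1; have [u1 Fu1 u1E] := unitri_basis phi 1.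
have FV : Fsub 2 v^-1%g by have [_ _] := Fsub_subgroup n 2; apply.
have := Un_twist phi FV.
rewrite vE v1E !autM uE (Un_fix1 phi Fv1) u1E !invgM.
have cancel2 (z : Free n) : (basis_elt 2 * ((basis_elt 2)^-1 * z) = z)%g by rewrite mulKVg.
rewrite -!mulgA !cancel2 autV !(lin_repM, twist_repM) twist_basis1 !mulmx1.
have [k [s [_ -> _]]] := Fsub1_image Fu1; have [k' [s' [_ -> _]]] := Fsub1_image Fv1.
move=> e; rewrite diagQ_mul mulrC -diagQ_mul !mulmxA -[_ *m lin_rep _ *m _]mulmxA e.
by rewrite mulmxA.
Qed.

Lemma Un_rep1 : Un_rep 1%g = 1%:M.
Proof. by rewrite /Un_rep /= mulgV mul1mx twist_basis1. Qed.

Hypothesis n3 : (n <= 3)%N.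
Hypothesis lin_rep_fix : forall w : Free n,
  all (fun a : 'I_n * bool => (a.1 < 2)%N) (fg_word w) ->
  lin_rep w *m col3 1 0 0 = col3 1 0 0 ->
  all (fun a : 'I_n * bool => (a.1 < 1)%N) (fg_word w).
Hypothesis two_pow_eq1 : forall s k, two_pow s k = 1 -> k = 0%N.

(** The vector [(1, 0, 0)] is fixed by [diagQ], hence by the image of [u^-1], so [u] is a power of
    [f_1]. The diagonal entries then show that [u] and [u1] are trivial. *)
Lemma Un_rep_ker phi : Un_rep phi = 1%:M -> phi = 1%g.
Proof.
have [u Fu uE] := unitri_basis phi 2; have [u1 Fu1 u1E] := unitri_basis phi 1.
rewrite /Un_rep uE u1E invgM mulKVg twist_repM twist_basis1 mulmx1.
have [k1 [s1 [_ tu1 k10]]] := Fsub1_image Fu1; rewrite tu1 => e.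
have FV : Fsub 2 u^-1%g by have [_ _] := Fsub_subgroup n 2; apply.
have := lin_rep_fix (Fsub_letters FV).
have Qe : diagQ (two_pow s1 k1) *m col3 1 0 0 = col3 1 0 0.
  by rewrite mat3_mul_col; congr col3; ring.
rewrite -{1}Qe mulmxA e mul1mx => /(_ erefl)/rank1_image[k [s [lu _ k0]]].
have := e; rewrite lu mat3_mul -mat3_1 => /matrixP e'.
have := e' 1 1; have := e' 2%:R 2%:R; rewrite !mxE /= !(mul0r, mulr0, addr0, add0r, mulr1).
move=> ez; have z1 : two_pow s k = 1 by rewrite -[LHS]invrK ez invr1.
rewrite z1 mul1r => /two_pow_eq1/k10 u11.
have u0 : u = 1%g by apply: invg_inj; rewrite invg1; apply/k0/(two_pow_eq1 z1).
apply: Un_eq => j; rewrite -[RHS]/(fgen j).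
have : (j < 3)%N by apply: leq_trans n3.
case Ej : (j : nat) => [|[|[|//]]] _.
- by apply: Un_fix1; apply: Fsub_gen; rewrite Ej.
- by rewrite -basis_elt_ord Ej u1E u11 mul1g.
- by rewrite -basis_elt_ord Ej uE u0 mul1g.
Qed.

Lemma Un_linear_of_faithful : linear_group (Un n).
Proof.
exists F, 3%N, Un_rep; split=> //.
- move=> x; have : Un_rep x *m Un_rep x^-1%g = 1%:M by rewrite -Un_repM mulgV Un_rep1.
  by case/mulmx1_unit.
- exact: Un_repM.
- move=> x y xy; have : (x * y^-1)%g = 1%g.
    by apply: Un_rep_ker; rewrite Un_repM xy -Un_repM mulgV Un_rep1.
  by move/(congr1 (fun z => z * y)%g); rewrite mulgKV mul1g.
Qed.

End Reps.

End Matrices.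

Definition deg_le (d : nat) (p : {poly rat}) := forall j, (d < j)%N -> p`_j = 0.

Lemma deg_leD d p q : deg_le d p -> deg_le d q -> deg_le d (p + q).
Proof. by move=> pd qd j dj; rewrite coefD pd ?qd ?addr0. Qed.

Lemma deg_leN d p : deg_le d p -> deg_le d (- p).
Proof. by move=> pd j dj; rewrite coefN pd ?oppr0. Qed.

Lemma deg_leZ d c p : deg_le d p -> deg_le d (c *: p).
Proof. by move=> pd j dj; rewrite coefZ pd ?mulr0. Qed.

Lemma deg_leSS d p : deg_le d p -> deg_le d.+2 p.
Proof. by move=> pd j dj; apply: pd; lia. Qed.

Lemma deg_leX d p : deg_le d p -> deg_le d.+2 ('X * p).
Proof. by move=> pd [|j] dj; rewrite coefXM //= pd //; lia. Qed.

Lemma deg_leX2 d p : deg_le d p -> deg_le d.+2 ('X^2 * p).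
Proof. by move=> pd [|[|j]] dj; rewrite coefXnM // !subSS subn0 pd. Qed.

Lemma coefX2_top d (p : {poly rat}) : ('X^2 * p)`_d.+2 = p`_d.
Proof. by rewrite coefXnM !subSS subn0. Qed.

Lemma coefSS_top d p : deg_le d p -> p`_d.+2 = 0.
Proof. by apply. Qed.

Lemma coefX_top d p : deg_le d p -> ('X * p)`_d.+2 = 0.
Proof. by move=> pd; rewrite coefXM pd. Qed.

(** * Faithfulness through leading coefficients in [t] *)

Section LeadingCoefficients.
Variables (K : fieldType) (f : {rmorphism {poly rat} -> K}) (n : nat).
Hypothesis f_inj : injective f.
Local Notation "x %:F" := (f x).
Notation t := (f 'X).

Lemma embed_eq0 p : (p%:F == 0) = (p == 0).
Proof. by rewrite -(inj_eq f_inj) rmorph0. Qed.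

Lemma natr_embed (m : nat) : m%:R = (m%:R%:P)%:F :> K.
Proof. by rewrite polyC_natr rmorph_nat. Qed.

Lemma scale_nat_embed m (p : {poly rat}) : (m%:R *: p)%:F = m%:R * p%:F :> K.
Proof. by rewrite scaler_nat rmorphMn /= mulr_natl. Qed.

Lemma natr_embed_inj (m k : nat) : m%:R = k%:R :> K -> m = k.
Proof.
rewrite !natr_embed => /f_inj/polyC_inj/eqP.
by rewrite eqr_nat => /eqP.
Qed.

Lemma two_neq0 : 2%:R != 0 :> K.
Proof. by apply/eqP => /(@natr_embed_inj 2 0). Qed.

Lemma embedX_neq0 : t != 0.
Proof. by rewrite embed_eq0 polyX_eq0. Qed.

Lemma two_pow_eq1 s k : two_pow K s k = 1 -> k = 0%N.
Proof.
have pow2 : (2%:R : K) ^+ k = 1 -> k = 0%N.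
  rewrite -natrX => /(@natr_embed_inj _ 1); case: k => // k.
  by rewrite expnS; lia.
rewrite /two_pow; case: s => //; rewrite exprVn => e.
by apply: pow2; rewrite -[LHS]invrK e invr1.
Qed.

(* Directions of the coefficient vector of top degree: [(1,0,0)], [(1,r,0)] and
   [(1,0,-r)]; the first letter of the word confines [r > 0]. *)
Definition top_direction (kind : nat) (r : rat) : rat * rat * rat :=
  match kind with 0 => (1, 0, 0) | 1 => (1, r, 0) | _ => (1, 0, - r) end.

Definition top_constraint (kind : nat) (r : rat) (w : seq ('I_n * bool)) : bool :=
  match kind, w with
  | 0, _ => true
  | _, [::] => false
  | 1, (i, s) :: _ =>
      if i == 0%N :> nat then (if s then r < 1 else 1 < r) else ~~ s && (r == 1)
  | _, (i, s) :: _ =>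
      if i == 0%N :> nat then (if s then 1 < r else r < 1) else s && (r == 1)
  end.

(** The integer [N] counts the letters [f_2] and their inverses. The denominator has degree [N] and
    the first numerator degree exactly [2 N], so the vector grows with [N]. *)
Definition top_form (w : seq ('I_n * bool)) : Prop :=
  exists (p1 p2 p3 : {poly rat}) (c k r : rat) (N kind : nat),
  [/\ [/\ c != 0, k != 0 & 0 < r],
      [/\ deg_le N.*2 p1, deg_le N.*2 p2 & deg_le N.*2 p3],
      foldr (fun a : 'I_n * bool => mulmx (lin_letter t a.1 a.2)) 1%:M w *m col3 1 0 0
        = ((c *: 'X^N)%:F)^-1 *: col3 (p1%:F) (p2%:F) (p3%:F),
      [/\ p1`_N.*2 = k * (top_direction kind r).1.1,
          p2`_N.*2 = k * (top_direction kind r).1.2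
        & p3`_N.*2 = k * (top_direction kind r).2]
    & top_constraint kind r w /\ (~~ all (fun a : 'I_n * bool => (a.1 < 1)%N) w -> (0 < N)%N)].

(** A letter on [f_1] multiplies or divides [r] by 2 and keeps the kind; [f_2] resets the direction
    to [(1, 1, 0)] and its inverse to [(1, 0, -1)], each raising [N] by 1. *)
Lemma reduced_top_form (w : seq ('I_n * bool)) :
  reduced w -> all (fun a : 'I_n * bool => (a.1 < 2)%N) w -> top_form w.
Proof.
elim: w => [|a w IHw] rw w2.
  exists 1, 0, 0, 1, 1, 1, 0%N, 0%N; split; rewrite ?double0 //.
  - by split=> // j; rewrite ?coef1 ?coef0 //; case: j.
  - by rewrite mul1mx expr0 scale1r rmorph1 invr1 scale1r rmorph0.
  - by split; rewrite ?coef1 ?coef0 /= ?mulr1 ?mulr0.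
have /andP[a2 w2'] := w2.
have [p1 [p2 [p3 [c [k [r [N [kind [[c0 k0 r0] [d1 d2 d3] wE tE [wc wN]]]]]]]]]] :=
  IHw (path_sorted rw) w2'.
have D0 : (c *: 'X^N)%:F != 0 :> K by rewrite embed_eq0 scaler_eq0 negb_or c0 -size_poly_eq0 size_polyXn.
pose D : K := (c *: 'X^N)%:F; rewrite -/D in wE D0.
have t0 := embedX_neq0; have two0 := two_neq0.
have four0 : 4%:R != 0 :> K by apply/eqP => /(@natr_embed_inj 4 0).
have DX m : ((m%:R * c) *: 'X^N)%:F = m%:R * D by rewrite -scalerA scale_nat_embed.
have DY m : ((m%:R * c) *: 'X^(N.+1))%:F = m%:R * (t * D).
  by rewrite -scalerA scale_nat_embed exprS scalerAr rmorphM.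
case: a a2 rw w2 => i s /= i2 rw _; rewrite /top_form /= -mulmxA wE.
case: (posnP i) => [i0|i0].
  have hd j s' w' : w = (j, s') :: w' -> j = 0%N :> nat -> s' = s.
    move=> ww j0; move: rw; rewrite ww /= => /andP[+ _].
    have -> : j = i by apply: val_inj; rewrite /= j0 i0.
    by rewrite /linv xpair_eqE eqxx /=; case: (s); case: (s').
  (* If the rest begins with the same letter, [r] is strictly on the required side of 1; if it
     begins with [f_2] or its inverse, [r = 1]. The factor 2 then makes the new inequality
     strict. *)
  have [wc1 wc2] : (kind = 1%N -> if s then r <= 1 else 1 <= r) /\
      ((1 < kind)%N -> if s then 1 <= r else r <= 1).
    move: wc hd; case: (kind) => [|[|?]] //=; case: (w) => [|[j s'] w'] //= wc /(_ _ _ _ erefl) hd;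
      split=> // _; move: wc; case: eqP => [/hd ->|_ /andP[_ /eqP ->]]; case: (s) => // /ltW //.
  have c2 : 2%:R * c != 0 by rewrite mulf_neq0.
  have k2 : 2%:R * k != 0 by rewrite mulf_neq0.
  case: tE => t1 t2 t3.
  case: s hd wc1 wc2 rw => hd wc1 wc2 rw.
  - exists (2%:R *: p1), p2, (4%:R *: p3), (2%:R * c), (2%:R * k),
      (if kind == 1%N then r / 2%:R else r * 2%:R), N, kind; split.
    + by split=> //; case: ifP => _; rewrite ?divr_gt0 ?mulr_gt0.
    + by split=> //; apply: deg_leZ.
    + by rewrite i0 lin_letter_XV_col // DX !scale_nat_embed.
    + by rewrite !coefZ t1 t2 t3; case: (kind) => [|[|?]] /=; split; field.
    + split; last by rewrite /= i0.
      by move: wc1 wc2; case: (kind) => [|[|?]] //=; rewrite i0 => wc1 wc2;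
        [have := wc1 erefl|have := wc2 isT]; rewrite /=; lra.
  - exists (2%:R *: p1), (4%:R *: p2), p3, (2%:R * c), (2%:R * k),
      (if kind == 1%N then r * 2%:R else r / 2%:R), N, kind; split.
    + by split=> //; case: ifP => _; rewrite ?divr_gt0 ?mulr_gt0.
    + by split=> //; apply: deg_leZ.
    + by rewrite i0 lin_letter_X_col // DX !scale_nat_embed.
    + by rewrite !coefZ t1 t2 t3; case: (kind) => [|[|?]] /=; split; field.
    + split; last by rewrite /= i0.
      by move: wc1 wc2; case: (kind) => [|[|?]] //=; rewrite i0 => wc1 wc2;
        [have := wc1 erefl|have := wc2 isT]; rewrite /=; lra.
have i1 : (i : nat) = 1%N by apply/eqP; rewrite eqn_leq i0 -ltnS i2.
have hd j s' w' : w = (j, s') :: w' -> j <> 0%N :> nat -> s' = s.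
  move=> ww j0; move: rw w2'; rewrite ww /= => /andP[+ _] /andP[j2 _].
  have -> : j = i by apply: val_inj; rewrite /= i1; move: j0 j2; case: (j : nat) => [|[|]].
  by rewrite /linv xpair_eqE eqxx /=; case: (s); case: (s').
case: tE => t1 t2 t3.
(* The new top coefficient could vanish only for [r = 1], when the rest begins with the inverse of
   the letter applied; reducedness excludes this. *)
have nz : (if s then p1`_N.*2 - p2`_N.*2 else p1`_N.*2 + p3`_N.*2) != 0.
  rewrite t1 t2 t3; move: wc hd; case: (kind) => [|[|?]] /=; case: (w) => [|[j s'] w'] //=;
    rewrite ?(mulr0, mulr1, subr0, addr0) ?if_same // => wc /(_ _ _ _ erefl) hd;
    case: (s) hd => hd; rewrite ?mulr1 ?mulr0 ?addr0 ?subr0 //; rewrite -{1}[k]mulr1 -?mulrBr -?mulrDr mulf_neq0 //;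
    move: wc; case: eqP => [_|/hd ->]; case: (s') => //=; lra.
rewrite i1.
have fX2 : ('X^2)%:F = t ^+ 2 by rewrite rmorphXn.
case: s rw hd nz => rw hd nz.
- exists ((1 + 'X^2) * p1 + (1 - 'X^2) * p2), (4%:R *: ('X * p3)),
    ((1 - 'X^2) * p1 + (1 + 'X^2) * p2), (4%:R * c), (p1`_N.*2 - p2`_N.*2), 1, N.+1, 2%N; rewrite doubleS; split.
  + by split=> //; rewrite mulf_neq0.
  + rewrite !mulrDl !mul1r !mulNr.
    by split; [| apply: deg_leZ; exact: deg_leX | ];
      do ![apply: deg_leD|apply: deg_leN|exact: deg_leSS|exact: deg_leX2].
  + rewrite lin_letter_YV_col // DY scale_nat_embed.
    by rewrite !(fX2, rmorphB, rmorphD, rmorph1, rmorphM).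
  + rewrite !mulrDl !mul1r !mulNr !(coefD, coefN, coefZ) coefX_top // !coefX2_top.
    by rewrite !coefSS_top //=; split; ring.
  + by rewrite /= i1.
- exists (('X^2 + 1) * p1 + ('X^2 - 1) * p3), (('X^2 - 1) * p1 + ('X^2 + 1) * p3),
    ('X * p2), (1%:R * c), (p1`_N.*2 + p3`_N.*2), 1, N.+1, 1%N; rewrite doubleS; split.
  + by split=> //; rewrite mul1r.
  + rewrite !mulrDl !mul1r !mulNr !mul1r.
    by split; [| | exact: deg_leX];
      do ![apply: deg_leD|apply: deg_leN|exact: deg_leSS|exact: deg_leX2].
  + rewrite lin_letter_Y_col // DY.
    by rewrite !(fX2, rmorphB, rmorphD, rmorph1, rmorphM).
  + rewrite !mulrDl !mul1r !mulNr !mul1r !(coefD, coefN) coefX_top // !coefX2_top.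
    by rewrite !coefSS_top //=; split; ring.
  + by rewrite /= i1.
Qed.

(** If [f_2] occurs in [w], then [0 < N], and fixing the vector would make the first numerator equal
    to [c *: 'X^N], whose coefficient of index [N.*2] is zero. *)
Lemma lin_rep_fix (w : Free n) :
  all (fun a : 'I_n * bool => (a.1 < 2)%N) (fg_word w) ->
  lin_rep t w *m col3 1 0 0 = col3 1 0 0 ->
  all (fun a : 'I_n * bool => (a.1 < 1)%N) (fg_word w).
Proof.
move=> w2 we; apply: contraT => w1.
have [p1 [p2 [p3 [c [k [r [N [kind [[c0 k0 _] _ wE [tE _ _] [_ wN]]]]]]]]]] :=
  reduced_top_form (fg_reduced w) w2.
have N0 := wN w1; have D0 : (c *: 'X^N)%:F != 0 :> K.
  by rewrite embed_eq0 scaler_eq0 negb_or c0 -size_poly_eq0 size_polyXn.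
rewrite we scale_col3 in wE; have [e1 _ _] := col3_inj wE.
have /f_inj p1E : p1%:F = (c *: 'X^N)%:F by rewrite -[RHS]mulr1 e1 mulVKf.
move: tE; rewrite p1E coefZ coefXn.
have -> : (N.*2 == N) = false by apply/negbTE; lia.
rewrite mulr0 => /esym/eqP; rewrite mulf_eq0 (negPf k0) /=.
by case: (kind) => [|[|?]] /=; rewrite oner_eq0.
Qed.

Lemma Un_linear_embedded : (n <= 3)%N -> linear_group (Un n).
Proof.
move=> n3; apply: (Un_linear_of_faithful embedX_neq0 two_neq0 n3).
  exact: lin_rep_fix.
exact: two_pow_eq1.
Qed.

End LeadingCoefficients.

Lemma Un_linear n : (n <= 3)%N -> linear_group (Un n).
Proof.
apply: (@Un_linear_embedded {fraction {poly rat}} (@tofrac {poly rat})).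
by move=> p q /eqP; rewrite tofrac_eq => /eqP.
Qed.

End LinearPart.

Theorem theorem1p1 (n : nat) (hn : 1 <= n) : linear_group (Un n) <-> n <= 3.
Proof.
split=> [Ul|]; last exact: Un_linear.
by rewrite leqNgt; apply/negP => /Un_nonlinear.
Qed.
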